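(* Let $\dim V\ge 4$ and fix $J\in\mathcal{T}(V,g)$. Let $QS\in\Gamma(\mathfrak{gl}(\mathbb{V}))$, with $Q\in\Gamma(\mathfrak{gl}(\mathbb{V}))$, be such that $Q^{*}=Q$, $[Q,J]=0$, $[Q,\phi]=0$ and $S\in\{\mathbb{1},\,J+\phi,\,J-\phi,\,[J,\phi]\}$. 1) $\mathcal{D}^{QS}$ is integrable if $$dQ_{QBQ}=Q(dQ_{B})Q\qquad\text{for all } B\in\mathcal{D}^{S}.$$ 2) $\mathcal{D}^{QS}_{\mathfrak{u}(J)}$ is integrable if $$dQ_{QCQ}=Q(dQ_{C})Q\qquad\text{for all } C\in\mathcal{D}^{S}_{\mathfrak{u}(J)}.$$
   Context: $(V,g)$ is a $2n$-dimensional real vector space with a positive definite metric. $\mathcal{T}=\mathcal{T}(V,g)=\{K\in \mathrm{End}V : K^{2}=-1,\ g(K\cdot,K\cdot)=g(\cdot,\cdot)\}$, a submanifold of $\mathrm{End}V$. $\mathbb{V}=V\times\mathcal{T}$, $\mathfrak{gl}(\mathbb{V})=\mathrm{End}V\times\mathcal{T}$. $\phi$ is the section with $\phi|_K=K$; $J$ and $\mathbb{1}$ are regarded as constant sections. $A^{*}$ is the $g$-adjoint, $[A,B]=AB-BA$. $\mathfrak{o}_{\{\phi\}}$ is the bundle over $\mathcal{T}$ with fiber $\{A\in\mathfrak{o}(V,g):AK+KA=0\}$ at $K$; it is identified with $T\mathcal{T}$. $\mathfrak{u}(V,J)=\{A\in\mathfrak{o}(V,g):[A,J]=0\}$. $dQ_X$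 is the derivative of the map $Q:\mathcal{T}\to\mathrm{End}V$ in direction $X\in T\mathcal{T}$. The distributions on $\mathcal{T}$ are defined pointwise (everything evaluated at $K\in\mathcal{T}$) by $$\mathcal{D}^{QS}=\{B\in\mathfrak{o}_{\{\phi\}} \ |\ B:\mathrm{Ker}QS\to 0,\ \mathrm{Im}QS\to\mathrm{Im}QS\},$$ $$\mathcal{D}^{QS}_{\mathfrak{u}(J)}=\{[B,\phi]\in\mathfrak{o}_{\{\phi\}} \ |\ B\in\mathfrak{u}(V,J),\ B:\mathrm{Ker}QS\to 0,\ \mathrm{Im}QS\to\mathrm{Im}QS\},$$ and $\mathcal{D}^{S}$, $\mathcal{D}^{S}_{\mathfrak{u}(J)}$ denote the case $Q=\mathbb{1}$. Integrability is in the generalized sense (rank may vary): through each point of $\mathcal{T}$ passes an integral submanifold, i.e. one whose tangent space at each of its points equals the distribution there. *)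

(* Defs.v *)
From HB Require Import structures.
From mathcomp Require Import all_boot all_order all_algebra.
From mathcomp Require Import all_classical all_reals all_analysis.

Set Implicit Arguments.
Unset Strict Implicit.
Unset Printing Implicit Defensive.
Import Order.TTheory GRing.Theory Num.Theory.
Import numFieldNormedType.Exports.
Import passmx.

Local Open Scope classical_set_scope.
Local Open Scope ring_scope.

(* The library puts no topology on 'Hom(U, V).  In finite dimension all norms
   give the same topology and the same calculus, so any choice is as good as
   another; we take the sup norm of the matrix in the bases [vbasis fullv]. *)
Section HomNorm.
Variables (R : realType) (U V : vectType R).

Definition hom_norm (f : 'Hom(U, V)) : R :=
  `| mxof (vbasis {:U}) (vbasis {:V}) f |.

Lemma ler_hom_normD f h : hom_norm (f + h) <= hom_norm f + hom_norm h.
Proof. by rewrite /hom_norm linearD ler_normD. Qed.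

Lemma hom_normZ (l : R) f : hom_norm (l *: f) = `|l| * hom_norm f.
Proof. by rewrite /hom_norm linearZ normrZ. Qed.

Lemma hom_norm_eq0 f : hom_norm f = 0 -> f = 0.
Proof.
move=> /eqP; rewrite /hom_norm normr_eq0 mxof_eq0 ?vbasisP// => /eqP//.
Qed.

HB.instance Definition _ := Lmodule_isNormed.Build R 'Hom(U, V)
  ler_hom_normD hom_normZ hom_norm_eq0.
End HomNorm.

Section Smooth.
Variables (R : realType) (E F : normedModType R).

(* C^oo on U (used for U open): every iterated directional derivative
   'D_v1 ('D_v2 (... ('D_vk f))), including f itself, is differentiable at
   every point of U. *)
Definition smooth_on (U : set E) (f : E -> F) : Prop :=
  forall (vs : seq E) (x : E), U x ->
    differentiable (foldr (fun v (h : E -> F) => 'D_v h) f vs) x.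
End Smooth.

Section Submanifold.
Variables (R : realType) (V : vectType R).
Local Notation E := 'End(V).
Implicit Types (N U : set E) (W : {vspace E}).

(* Phi, with inverse Psi, is a diffeomorphism from the open set U onto an open
   set, which straightens N to the linear subspace W. *)
Definition slice_chart W N U (Phi Psi : E -> E) : Prop :=
  [/\ open U /\ open (Phi @` U),
      smooth_on U Phi,
      smooth_on (Phi @` U) Psi,
      {in U, cancel Phi Psi} &
      Phi @` (U `&` N) = (Phi @` U) `&` [set x | x \in W]].

Definition submanifold N : Prop :=
  exists W, forall p, N p ->
    exists U Phi Psi, U p /\ slice_chart W N U Phi Psi.

(* Velocities at p of the smooth curves lying in N. *)
Definition tangent_space N (p : E) : set E :=
  [set X | exists (e : R) (c : R -> E),
     [/\ 0 < e,
         smooth_on (ball (0 : R) e) c,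
         c 0 = p,
         (forall t, ball (0 : R) e t -> N (c t)) &
         'D_1 c 0 = X]].
End Submanifold.

Section Twistor.
Variables (R : realType) (V : vectType R) (g : {dot V for idfun}).
Local Notation E := 'End(V).
Implicit Types (A B C J K L X P : E) (N : set E).

Definition comm_lfun A B : E := (A \o B)%VF - (B \o A)%VF.

Definition twistor : set E :=
  [set K | (K \o K)%VF = - \1%VF /\ forall u v, g (K u) (K v) = g u v].

Definition self_adjoint A : Prop := forall u v, g (A u) v = g u (A v).

Definition ortho_alg : set E := [set A | forall u v, g (A u) v = - g u (A v)].

Definition unitary_alg J : set E :=
  [set A | ortho_alg A /\ comm_lfun A J = 0].

(* The fibre at K of the bundle o_{phi}, which is the tangent space to
   [twistor] at K. *)
Definition ortho_anti K : set E :=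
  [set A | ortho_alg A /\ (A \o K)%VF + (K \o A)%VF = 0].

(* Sections of End V over [twistor] are given by total maps E -> E of which only
   the values on [twistor] matter. *)
Definition smooth_extension (Q : E -> E) K (F : E -> E) : Prop :=
  exists U : set E,
    [/\ open U, U K, smooth_on U F & forall L, U L -> twistor L -> F L = Q L].

Definition smooth_section (Q : E -> E) : Prop :=
  forall K, twistor K -> exists F, smooth_extension Q K F.

(* dQ_X at K, for Q a smooth section and X tangent to [twistor] at K: the
   derivative along X of a local smooth extension of Q, all of which have the
   same derivative in tangent directions. *)
Definition dsection (Q : E -> E) K X : E :=
  'D_X (xget Q [set F | smooth_extension Q K F]) K.

Definition ker_im_compat P B : Prop :=
  (B @: lker P = 0)%VS /\ (B @: limg P <= limg P)%VS.

(* Distributions on [twistor], as families of subsets of the tangent spaces.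
   P stands for the section QS. *)
Definition distr (P : E -> E) K : set E :=
  [set B | ortho_anti K B /\ ker_im_compat (P K) B].

Definition distr_u J (P : E -> E) K : set E :=
  [set C | ortho_anti K C /\
     exists B, [/\ unitary_alg J B, ker_im_compat (P K) B & C = comm_lfun B K]].

Definition integral_submanifold (D : E -> set E) N : Prop :=
  [/\ N `<=` twistor, submanifold N & forall L, N L -> tangent_space N L = D L].

Definition integrable_distr (D : E -> set E) : Prop :=
  forall K, twistor K -> exists N, N K /\ integral_submanifold D N.

Definition S_sections J : set (E -> E) :=
  [set S | [\/ S = (fun=> \1%VF),
               S = (fun K => J + K),
               S = (fun K => J - K) |
               S = (fun K => comm_lfun J K)]].
End Twistor.

(* Main.v *)
Require Import Defs.
From HB Require Import structures.
From mathcomp Require Import all_boot all_order all_algebra.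
From mathcomp Require Import all_classical all_reals all_analysis.
From mathcomp Require Import ring lra.
Set Implicit Arguments.
Unset Strict Implicit.
Unset Printing Implicit Defensive.
Import Order.TTheory GRing.Theory Num.Theory.
Import numFieldNormedType.Exports.
Import passmx.
Local Open Scope classical_set_scope.
Local Open Scope ring_scope.

(** Put [P = Q S].  As [Q] is self-adjoint and commutes with [J] and [phi], the
    endomorphism [P] is symmetric or skew at each point; its kernel and image are
    orthogonal complements, stable under [J] and [phi], and a skew endomorphism
    that kills the kernel preserves the image.  A tangent vector [C] of the twistor
    space at [K] is the commutator of [- C K / 2] with [K].  So both distributions
    consist, at [K], of the commutators [[B, K]] where [B] is skew, kills the
    kernel of [P] at [K] and commutes with the members of [G]: here [G] is empty
    for the first distribution and is [J] alone for the second
    ([orbit_distr], [distrE], [distr_uE]).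

    If the kernel of [P] were known to be constant along a leaf, say equal to [V0],
    the leaf would be an orbit of the group of isometries that commute with [G] and
    fix [V0] pointwise.  Conversely, let [V0] be the kernel of [P] at a given [K0],
    and let [N] be a small piece of the orbit of [K0] under that group.

    The kernel of [P] is [V0] all along [N] ([leaf_kernel]).  Let [p] be the
    projection on [V0], and consider the velocity [C = [B, K]] of a curve in [N].
    The hypothesis on [dQ] speaks of the directions [Q A Q], and it is not known
    beforehand that [C] is one of them.  But [Q] has a partial inverse [X]
    ([pinv]), and [A = X C X = [X B X, K]] is a direction that the hypothesis
    allows, such that [Q A Q - C] is bounded by [f1 = Q S p] and [f2 = p S Q].  The
    hypothesis then bounds the derivatives of [f1] and [f2] along the curve by
    [f1] and [f2] themselves ([growth_bound]).  Both vanish at [K0], so they vanish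
    along the curve ([small_growth_zero]), and no flow has to be constructed.

    The set [N] is a submanifold with the right tangent spaces ([leaf_of_lift]).
    Conjugation by Cayley transforms parametrizes the orbit by the tangent space
    at [K0] ([orb], [is_diff_orb]); adding a complement gives a self-map of the
    space of endomorphisms whose derivative at the origin is the identity, and
    [inverse_function], proved by contraction, supplies the slice chart.  The
    velocities at a point [L] of [N] are among the [[B, L]]; they are all of them,
    because conjugation by the isometry that moves [K0] to [L] shows the space of
    the [[B, L]] to be no larger at [L] than at [K0].

    Smoothness is handled coinductively ([smooth_coind]): a class of differentiable
    maps closed under directional derivatives consists of smooth maps. *)

(** * Normed spaces of linear maps *)

Section HomNormTheory.
Variables (R : realType) (U V : vectType R).
Local Notation mx A := (mxof (vbasis {:U}) (vbasis {:V}) A).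
Implicit Types A : 'Hom(U, V).

Lemma hom_normE A : `|A| = `|mx A|.
Proof. by []. Qed.

Definition mx_entry i j A : R^o := mx A i j.

Lemma mx_entry_is_linear i j : linear (mx_entry i j).
Proof. by move=> a A B; rewrite /mx_entry linearP !mxE. Qed.
HB.instance Definition _ i j := GRing.isLinear.Build R 'Hom(U, V) R^o _
  (mx_entry i j) (mx_entry_is_linear i j).

Lemma mx_entry_le A i j : `|mx_entry i j A| <= `|A|.
Proof.
rewrite hom_normE [`|mx A|]mx_normrE.
exact: (le_bigmax _ (fun ij => `|mx A ij.1 ij.2|) (i, j)).
Qed.

Lemma hom_norm_le A k : 0 <= k -> (forall i j, `|mx_entry i j A| <= k) -> `|A| <= k.
Proof.
move=> k0 Ak; rewrite hom_normE [`|mx A|]mx_normrE.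
by apply/bigmax_leP; split=> // -[i j] _ /=; exact: Ak.
Qed.

Definition hom_unit i j : 'Hom(U, V) :=
  hommx (vbasis {:U}) (vbasis {:V}) (delta_mx i j).

Lemma hom_unit_sum A : A = \sum_i \sum_j mx_entry i j A *: hom_unit i j.
Proof.
rewrite -[LHS](mxofK (vbasisP _) (vbasisP _)) [X in hommx _ _ X]matrix_sum_delta.
rewrite linear_sum; apply: eq_bigr => i _; rewrite linear_sum.
by apply: eq_bigr => j _; rewrite linearZ.
Qed.

(** Linear maps out of a finite-dimensional space are bounded, since they are
    determined by finitely many values. *)
Lemma hom_linear_bounded (W : normedModType R) (f0 : 'Hom(U, V) -> W) :
  linear f0 -> exists2 k, 0 <= k & forall A, `|f0 A| <= k * `|A|.
Proof.
move=> f0L.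
pose f : {linear _ -> _} := HB.pack f0 (GRing.isLinear.Build R _ _ _ _ f0L).
rewrite -[f0]/(f : _ -> _).
exists (\sum_i \sum_j `|f (hom_unit i j)|).
  by apply: sumr_ge0 => i _; apply: sumr_ge0.
move=> A; rewrite {1}(hom_unit_sum A) linear_sum mulr_suml.
apply: le_trans (ler_norm_sum _ _ _) _; apply: ler_sum => i _.
rewrite linear_sum mulr_suml.
apply: le_trans (ler_norm_sum _ _ _) _; apply: ler_sum => j _.
by rewrite linearZ normrZ mulrC ler_wpM2l// mx_entry_le.
Qed.

Lemma hom_linear_continuous (W : normedModType R) (f0 : 'Hom(U, V) -> W) :
  linear f0 -> continuous f0.
Proof.
move=> f0L; have [k k0 fk] := hom_linear_bounded f0L.
pose f : {linear _ -> _} := HB.pack f0 (GRing.isLinear.Build R _ _ _ _ f0L).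
rewrite -[f0]/(f : _ -> _); apply: bounded_linear_continuous; apply/linear_boundedP.
exists k; split=> [|r kr x]; first exact: ger0_real.
by apply: le_trans (fk x) _; rewrite ler_wpM2r// ltW.
Qed.

Lemma hom_cauchy_cvg (F : set_system 'Hom(U, V)) :
  ProperFilter F -> cauchy F -> cvg F.
Proof.
move=> FF cF; pose m (A : 'Hom(U, V)) := mx A.
have : cvg (m @ F).
  apply/cauchy_cvgP/cauchy_ballP => e e0.
  have /cauchy_ballP/(_ e e0) := cF.
  case=> [[B C]] /= [FB FC] BC; exists (m @` B, m @` C) => /=.
    by split; [apply: filterS FB|apply: filterS FC] => A BA; exists A.
  move=> [_ _] /= [[A BA <-] [A' CA' <-]].
  have := BC (A, A') (conj BA CA').
  by rewrite -!ball_normE /= /m -linearB.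
move=> /cvg_ex[M mM]; apply/cvg_ex; exists (hommx (vbasis {:U}) (vbasis {:V}) M).
apply/cvgrPdist_lt => e e0; move/cvgrPdist_lt: mM => /(_ e e0).
rewrite !near_map; apply: filterS => A.
by rewrite hom_normE linearB /= hommxK // ?vbasisP.
Qed.

HB.instance Definition _ := Uniform_isComplete.Build 'Hom(U, V) hom_cauchy_cvg.

End HomNormTheory.

Section CompNorm.
Variables (R : realType) (V : vectType R).
Local Notation E := 'End(V).
Local Notation d := ((\dim {:V})%:R : R).

Lemma comp_lfun_norm (A B : E) : `|(A \o B)%VF| <= d * `|A| * `|B|.
Proof.
apply: hom_norm_le => [|i j]; first by rewrite !mulr_ge0.
rewrite /mx_entry (@mxof_comp _ _ _ _ _ (vbasis {:V}) _ (vbasisP _)) mxE.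
apply: le_trans (ler_norm_sum _ _ _) _.
have -> : d * `|A| * `|B| = \sum_(k < \dim {:V}) `|B| * `|A|.
  by rewrite sumr_const card_ord -[RHS]mulr_natl mulrAC mulrA.
by apply: ler_sum => k _; rewrite normrM ler_pM// mx_entry_le.
Qed.

Lemma comp_lfun_is_bilinear : bilinear_for
  (GRing.Scale.Law.clone _ _ *:%R _) (GRing.Scale.Law.clone _ _ *:%R _)
  (@comp_lfun R V V V).
Proof.
split=> [A|A] a X Y /=.
- by rewrite comp_lfunDl comp_lfunZl.
- by rewrite comp_lfunDr comp_lfunZr.
Qed.
HB.instance Definition _ :=
  bilinear_isBilinear.Build R E E E _ _ (@comp_lfun R V V V)
  comp_lfun_is_bilinear.

Lemma comp_lfun_continuous : continuous (fun p : E * E => (p.1 \o p.2)%VF).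
Proof.
have -> : (fun p : E * E => (p.1 \o p.2)%VF) = (fun p => \sum_i \sum_j
    mx_entry i j p.1 *: (hom_unit i j \o p.2)%VF).
  apply/funext => p; rewrite {1}(hom_unit_sum p.1).
  rewrite -[LHS]/(applyr (@comp_lfun R V V V) p.2 _) linear_sum.
  apply: eq_bigr => i _; rewrite linear_sum; apply: eq_bigr => j _.
  by rewrite linearZ.
move=> -[A B]; apply: cvg_big => [|i _]; first exact: add_continuous.
apply: cvg_big => [|j _]; first exact: add_continuous.
apply: cvgZ.
  apply: (@cvg_comp _ _ _ fst (mx_entry i j) _ (nbhs A)); first exact: cvg_fst.
  exact/hom_linear_continuous/mx_entry_is_linear.
apply: (@cvg_comp _ _ _ snd (comp_lfun (hom_unit i j)) _ (nbhs B)).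
  exact: cvg_snd.
apply: hom_linear_continuous => a X Y.
by rewrite comp_lfunDr comp_lfunZr.
Qed.
End CompNorm.

(** * Differentials *)

Section Differentials.
Variables (R : realType) (E F G : normedModType R).

Lemma is_diffI (f df : E -> F) x : linear df -> continuous df ->
  (forall e, 0 < e ->
    \forall h \near 0, `|f (h + x) - f x - df h| <= e * `|h|) ->
  is_diff x f df.
Proof.
move=> dfL dfC fdf.
pose l : {linear _ -> _} := HB.pack df (GRing.isLinear.Build R _ _ _ _ dfL).
have eqo : f \o shift x = cst (f x) + l +o_ 0 id.
  apply/eqaddoP => e e0; near=> h.
  rewrite -[X in `|X| <= _]/(f (h + x) - (f x + df h)) opprD addrA.
  by near: h; exact: fdf.
have dl : 'd f x = l :> (E -> F) by exact: diff_unique.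
split; last exact: dl.
by apply/diff_locallyP; rewrite dl.
Unshelve. all: by end_near. Qed.

Lemma is_diff_near (f df : E -> F) x e : is_diff x f df -> 0 < e ->
  \forall h \near 0, `|f (h + x) - f x - df h| <= e * `|h|.
Proof.
move=> [fx <-] e0; have := diff_locally fx; move/eqaddoP => /(_ e e0).
apply: filterS => h.
by rewrite -[X in `|X| <= _]/(f (h + x) - (f x + 'd f x h)) opprD addrA.
Qed.

Lemma is_diff_linear (f df : E -> F) x : is_diff x f df -> linear df.
Proof. by move=> [_ <-] a u v; rewrite linearP. Qed.

Lemma is_diff_continuous (f df : E -> F) x : is_diff x f df -> continuous df.
Proof. by move=> [fx <-]; exact: diff_continuous. Qed.

Lemma near_is_diff (f g df : E -> F) x :
  (\forall y \near x, f y = g y) -> is_diff x f df -> is_diff x g df.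
Proof.
move=> fg fx; apply: is_diffI.
- exact: is_diff_linear fx.
- exact: is_diff_continuous fx.
move=> e e0; have := is_diff_near fx e0; rewrite -(nbhs_singleton fg).
have {fg} : \forall h \near 0, f (h + x) = g (h + x).
  move: fg; rewrite (near_shift 0)/=; apply: filterS => y.
  by rewrite /= subr0.
by apply: filterS2 => h ->.
Qed.

Lemma is_diff_comp (f df : E -> F) (g dg : F -> G) x :
  is_diff x f df -> is_diff (f x) g dg -> is_diff x (g \o f) (dg \o df).
Proof.
by move=> [fx <-] [gx <-]; split; [exact: differentiable_comp|exact: diff_comp].
Qed.

Lemma is_diff_affine (l : E -> F) (c : F) x : linear l -> continuous l ->
  is_diff x (fun y => l y + c) l.
Proof.
move=> lL lC; apply: is_diffI => // e e0; near=> h.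
have -> : l (h + x) + c - (l x + c) - l h = 0.
  by rewrite -[h]scale1r lL !scale1r opprD addrACA subrr addr0 addrK subrr.
by rewrite normr0 mulr_ge0// ltW.
Unshelve. all: by end_near. Qed.

Lemma is_diff_derive (f df : E -> F) x v : is_diff x f df -> 'D_v f x = df v.
Proof. by move=> [fx <-]; rewrite deriveE. Qed.

Lemma differentiable_is_diff (f : E -> F) x : differentiable f x ->
  is_diff x f (fun v => 'D_v f x).
Proof. by move=> fx; split=> //; apply/funext => v; rewrite deriveE. Qed.

End Differentials.

(** * Smooth maps *)

Section SmoothTheory.
Variables (R : realType) (E F : normedModType R) (U : set E).
Hypothesis oU : open U.
Implicit Types f g : E -> F.

Lemma smooth_is_diff f x : smooth_on U f -> U x ->
  is_diff x f (fun v => 'D_v f x).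
Proof. by move=> fU Ux; exact/differentiable_is_diff/(fU [::]). Qed.

Lemma smooth_derive f v : smooth_on U f -> smooth_on U (fun x => 'D_v f x).
Proof. by move=> fU vs x Ux; have := fU (rcons vs v) x Ux; rewrite foldr_rcons. Qed.

Lemma near_eq_on f g x : (forall y, U y -> f y = g y) -> U x ->
  \forall y \near x, f y = g y.
Proof.
by move=> fg Ux; apply: filterS fg _; apply: open_nbhs_nbhs.
Qed.

(** Smoothness is coinductive: a class of differentiable maps that is closed
    under directional derivatives, up to equality on the open set, consists of
    smooth maps.  This avoids any induction on the order of derivation. *)
Lemma smooth_coind (C : (E -> F) -> Prop) :
  (forall f, C f -> exists2 df : E -> E -> F,
     forall x, U x -> is_diff x f (df x) & forall v, C (fun x => df x v)) ->
  forall f, C f -> smooth_on U f.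
Proof.
move=> CP f Cf vs x Ux.
suff [g [Cg fg]] : exists g, C g /\ forall y, U y ->
    foldr (fun v (h : E -> F) => 'D_v h) f vs y = g y.
  have [dg gdg _] := CP g Cg.
  suff [] : is_diff x (foldr (fun v (h : E -> F) => 'D_v h) f vs) (dg x) by [].
  by apply: near_is_diff (gdg x Ux); apply: near_eq_on Ux => y /fg ->.
elim: vs => [|v vs [g [Cg fg]]] /=; first by exists f.
have [dg gdg dgC] := CP g Cg; exists (fun y => dg y v); split=> // y Uy.
rewrite (near_eq_derive (g := g)); last exact: near_eq_on.
exact: is_diff_derive (gdg y Uy).
Qed.

Lemma smooth_ext f g : (forall x, U x -> f x = g x) ->
  smooth_on U f -> smooth_on U g.
Proof.
move=> fg fU.
pose C (h : E -> F) := exists2 k, smooth_on U k & forall x, U x -> k x = h x.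
refine (@smooth_coind C _ _ _); last by exists f.
move=> h [k kU kh]; exists (fun x v => 'D_v k x) => [x Ux|v].
  by apply: near_is_diff (smooth_is_diff kU Ux); exact: near_eq_on.
by exists (fun x => 'D_v k x) => //; exact: smooth_derive.
Qed.

Lemma smooth_cst (c : F) : smooth_on U (fun=> c).
Proof.
refine (@smooth_coind (fun f => exists a, f = cst a) _ _ _); last by exists c.
move=> _ [a ->]; exists (fun _ _ => 0) => [x _|v]; last by exists 0.
exact: is_diff_cst.
Qed.

Lemma smooth_linear f : linear f -> continuous f -> smooth_on U f.
Proof.
move=> fL fC.
refine (@smooth_coind (fun h => h = f \/ exists a, h = cst a) _ _ _); last by left.
move=> _ [->|[a ->]].
  exists (fun _ v => f v) => [x _|v]; last by right; exists (f v).
  apply: is_diffI => // e e0; near=> h.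
  by rewrite -[h]scale1r fL !scale1r addrK subrr normr0 mulr_ge0// ltW.
exists (fun _ _ => 0) => [x _|v]; last by right; exists 0.
exact: is_diff_cst.
Unshelve. all: by end_near. Qed.

Lemma smooth_add f g : smooth_on U f -> smooth_on U g ->
  smooth_on U (fun x => f x + g x).
Proof.
move=> fU gU; pose C (h : E -> F) := exists f' g',
  [/\ smooth_on U f', smooth_on U g' & h = fun x => f' x + g' x].
refine (@smooth_coind C _ _ _); last by exists f, g.
move=> _ [f' [g' [f'U g'U ->]]].
exists (fun x v => 'D_v f' x + 'D_v g' x) => [x Ux|v].
  have f'x := smooth_is_diff f'U Ux; have g'x := smooth_is_diff g'U Ux.
  exact: is_diffD.
by exists (fun x => 'D_v f' x), (fun x => 'D_v g' x); split=> //;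
  exact: smooth_derive.
Qed.

Lemma smooth_sum (I : finType) (f : I -> E -> F) :
  (forall i, smooth_on U (f i)) -> smooth_on U (fun x => \sum_i f i x).
Proof.
move=> fU; elim: (index_enum I) => [|i s IHs].
  by apply: smooth_ext (smooth_cst 0) => x _; rewrite big_nil.
apply: smooth_ext (smooth_add (fU i) IHs) => x _; by rewrite big_cons.
Qed.

End SmoothTheory.

Lemma smooth_sub (R : realType) (E F : normedModType R) (U U' : set E)
  (f : E -> F) : U' `<=` U -> smooth_on U f -> smooth_on U' f.
Proof. by move=> UU' fU vs x /UU'; exact: fU. Qed.

Lemma smooth_linear_comp (R : realType) (E F G : normedModType R) (U : set E)
    (l : F -> G) (f : E -> F) : open U -> linear l -> continuous l ->
  smooth_on U f -> smooth_on U (l \o f).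
Proof.
move=> oU lL lC fU.
refine (@smooth_coind _ _ _ _ oU
  (fun h => exists2 k, smooth_on U k & h = l \o k) _ _ _); last by exists f.
move=> _ [k kU ->]; exists (fun x v => l ('D_v k x)) => [x Ux|v]; last first.
  by exists (fun x => 'D_v k x) => //; exact: smooth_derive.
apply: is_diff_comp (smooth_is_diff kU Ux) _.
apply: is_diffI => // e e0; near=> h.
by rewrite -[h]scale1r lL !scale1r addrK subrr normr0 mulr_ge0// ltW.
Unshelve. all: by end_near. Qed.

Lemma is_diff_line (R : realType) (E F : normedModType R) (f df : E -> F)
    (a v : E) (t : R) : is_diff (t *: v + a) f df ->
  is_diff t (fun t => f (t *: v + a)) (fun s => s *: df v).
Proof.
move=> ft; have lt : is_diff t (fun t : R => t *: v + a) (fun s : R => s *: v).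
  apply: is_diffI => [b x y||e e0].
  - by rewrite scalerDl scalerA.
  - exact: scalel_continuous.
  near=> h.
  by rewrite scalerDl -(addrA (h *: v)) addrK subrr normr0 mulr_ge0// ltW.
have [d1 d2] := is_diff_comp lt ft; split=> //; rewrite d2.
by apply/funext => s /=; case: ft => _ <-; rewrite linearZ.
Unshelve. all: by end_near. Qed.

Lemma smooth_line (R : realType) (E F : normedModType R) (U : set E)
    (I : set R) (f : E -> F) (a v : E) :
  open U -> open I -> (forall t, I t -> U (t *: v + a)) -> smooth_on U f ->
  smooth_on I (fun t => f (t *: v + a)).
Proof.
move=> oU oI IU fU.
pose C (h : R -> F) := exists2 k, smooth_on U k & h = fun t => k (t *: v + a).
refine (@smooth_coind _ _ _ _ oI C _ _ _); last by exists f.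
move=> _ [k kU ->].
exists (fun t s => s *: 'D_v k (t *: v + a)) => [t It|s].
  exact: is_diff_line (smooth_is_diff kU (IU t It)).
exists (fun x => s *: 'D_v k x) => //.
apply: (@smooth_linear_comp _ _ _ _ _ ( *:%R s)) => //.
- by move=> b x y; rewrite scalerDr !scalerA mulrC.
- exact: scaler_continuous.
- exact: smooth_derive.
Qed.

(** * Smooth maps into an endomorphism algebra *)

Section EndCalculus.
Variables (R : realType) (V : vectType R).
Local Notation E := 'End(V).
Local Notation d := ((\dim {:V})%:R : R).
Implicit Types A B H X : E.

Lemma is_diff_comp_lfun (D : normedModType R) (f g df dg : D -> E) x :
  is_diff x f df -> is_diff x g dg ->
  is_diff x (fun y => (f y \o g y)%VF)
    (fun v => (f x \o dg v)%VF + (df v \o g x)%VF).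
Proof.
move=> [fx <-] [gx <-].
have bx : is_diff (f x, g x) (fun p : E * E => (p.1 \o p.2)%VF)
    (fun q => (f x \o q.2)%VF + (q.1 \o g x)%VF).
  have := @diff_bilin R E E E (@comp_lfun R V V V) (f x, g x)
    (@comp_lfun_continuous R V).
  have := @differentiable_bilin R E E E (@comp_lfun R V V V) (f x, g x)
    (@comp_lfun_continuous R V).
  by split.
have px : is_diff x (fun y => (f y, g y)) (fun v => ('d f x v, 'd g x v)).
  by split; [exact: differentiable_pair|exact: diff_pair].
exact: is_diff_comp px bx.
Qed.

Definition invertible : set E := [set A | lker A = 0%VS].

(** Testing injectivity on endomorphisms instead of vectors keeps to the one norm
    at hand, that of the endomorphisms. *)
Lemma invertibleP A : (forall X, (A \o X)%VF = 0 -> X = 0) -> invertible A.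
Proof.
move=> A0; rewrite /invertible /=; rewrite -(limg_proj (lker A)).
rewrite (A0 (projv (lker A))) ?lim0g//; apply/lfunP => v.
by rewrite comp_lfunE zero_lfunE; apply/eqP; rewrite -memv_ker memv_proj.
Qed.

Lemma comp_lfunV A : invertible A -> (A \o A^-1)%VF = \1%VF.
Proof. by move=> /eqP A0; exact: lker0_compfV. Qed.

Lemma comp_Vlfun A : invertible A -> (A^-1 \o A)%VF = \1%VF.
Proof. by move=> /eqP A0; exact: lker0_compVf. Qed.

(** The resolvent identity: it makes inversion Lipschitz and identifies its
    differential. *)
Lemma resolvent A B : invertible A -> invertible B ->
  (B^-1)%VF - (A^-1)%VF = (B^-1 \o (A - B) \o A^-1)%VF.
Proof.
move=> iA iB; rewrite comp_lfunDr comp_lfunNr comp_lfunDl comp_lfunNl.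
by rewrite comp_Vlfun// -comp_lfunA comp_lfunV// comp_lfun1l comp_lfun1r.
Qed.

Lemma near_invertible A : invertible A -> exists c, 0 < c /\
  \forall H \near 0, invertible (H + A) /\ `|((H + A)^-1)%VF| <= c.
Proof.
move=> iA; pose a := d * d * `|(A^-1)%VF| + 1.
have a0 : 0 < a by rewrite ltr_wpDl// !mulr_ge0.
(* Composition with the perturbation [A^-1 H] halves norms at least. *)
have key H X : `|H| <= (2 * a)^-1 -> `|(A^-1 \o H \o X)%VF| <= 2^-1 * `|X|.
  move=> Ha; apply: le_trans (comp_lfun_norm _ _) _.
  apply: ler_wpM2r => //; apply: (@le_trans _ _ (a * `|H|)).
    rewrite (le_trans (ler_wpM2l _ (comp_lfun_norm _ _)))//.
    by rewrite !mulrA ler_wpM2r// lerDl.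
  by rewrite -ler_pdivlMl// mulrC -invfM.
have nH : \forall H \near (0 : E), `|H| <= (2 * a)^-1.
  apply/nbhs_norm0P; exists (2 * a)^-1 => /=; first by rewrite invr_gt0 mulr_gt0.
  by move=> H /= /ltW.
exists (2 * `|(A^-1)%VF| + 1); split; first by rewrite ltr_wpDl// mulr_ge0.
apply: filterS nH => H Ha.
have iB : invertible (H + A).
  apply: invertibleP => X /eqP; rewrite comp_lfunDl addr_eq0 => /eqP HX.
  apply/eqP; rewrite -normr_le0.
  have /(_ X) := key H _ Ha.
  rewrite -comp_lfunA HX comp_lfunNr comp_lfunA comp_Vlfun// comp_lfun1l normrN.
  have := normr_ge0 X; lra.
split=> //; have := key H _ Ha.
move=> _; pose b := `|((H + A)^-1)%VF|; rewrite -/b.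
have : `|((H + A)^-1)%VF - (A^-1)%VF| <= 2^-1 * b.
  have -> : ((H + A)^-1)%VF - (A^-1)%VF = - (A^-1 \o H \o (H + A)^-1)%VF.
    rewrite -[LHS]opprB resolvent// addrK.
    by [].
  by rewrite normrN key.
move=> le1; have := ler_normD (((H + A)^-1)%VF - (A^-1)%VF) (A^-1)%VF.
rewrite subrK -/b; move: le1; have := normr_ge0 (A^-1)%VF; lra.
Qed.

Lemma invertible_open : open invertible.
Proof.
rewrite openE => A /near_invertible[c [_ iA]]; rewrite /interior /=.
rewrite -[nbhs A _]/(\forall B \near A, invertible B) (near_shift 0) /= subr0.
by apply: filterS iA => H [].
Qed.

Lemma is_diff_inv A : invertible A ->
  is_diff A (fun B => (B^-1)%VF) (fun H => - (A^-1 \o H \o A^-1)%VF).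
Proof.
move=> iA; have [c [c0 nA]] := near_invertible iA.
have dL : linear (fun H => - (A^-1 \o H \o A^-1)%VF).
  move=> a X Y; rewrite comp_lfunDr comp_lfunDl -comp_lfunZr -comp_lfunZl.
  by rewrite opprD scalerN.
apply: is_diffI => // [|e e0]; first exact: hom_linear_continuous.
pose k := d * (d * (d * (d * c) * `|(A^-1)%VF|)) * `|(A^-1)%VF| + 1.
have k0 : 0 < k by rewrite ltr_wpDl// !mulr_ge0// ltW.
have nH : \forall H \near (0 : E), `|H| <= e / k.
  apply/nbhs_norm0P; exists (e / k) => /=; first by rewrite divr_gt0.
  by move=> H /= /ltW.
apply: filterS2 nA nH => H [iB Bc] He.
have bHa : ((H + A)^-1 \o H \o A^-1)%VF = (A^-1)%VF - ((H + A)^-1)%VF.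
  rewrite -[RHS]opprB resolvent//.
  have -> : A - (H + A) = - H by rewrite opprD addrCA subrr addr0.
  by rewrite comp_lfunNr comp_lfunNl opprK.
have -> : ((H + A)^-1)%VF - (A^-1)%VF - - (A^-1 \o H \o A^-1)%VF =
    ((H + A)^-1 \o H \o A^-1 \o H \o A^-1)%VF.
  by rewrite bHa !comp_lfunDl !comp_lfunNl bHa opprB opprK addrC.
apply: (@le_trans _ _ (k * `|H| * `|H|)); last first.
  by rewrite ler_wpM2r// mulrC -ler_pdivlMr.
apply: (@le_trans _ _ ((d * (d * (d * (d * c) * `|(A^-1)%VF|)) * `|(A^-1)%VF|)
    * `|H| * `|H|)); last by rewrite !ler_wpM2r// lerDl.
have step (X Y : E) x : `|X| <= x -> `|(X \o Y)%VF| <= d * x * `|Y|.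
  move=> Xx; apply: le_trans (comp_lfun_norm _ _) _.
  by rewrite ler_wpM2r// ler_wpM2l.
have := step _ (A^-1)%VF _ (step _ H _ (step _ (A^-1)%VF _ (step _ H _ Bc))).
by move/le_trans; apply; rewrite le_eqVlt; apply/orP; left; apply/eqP; ring.
Qed.

Section SmoothEnd.
Variables (D : normedModType R) (U : set D).
Hypothesis oU : open U.
Implicit Types f g : D -> E.

(** The algebra generated by smooth maps and by the pointwise inverse of a
    smooth map is closed under derivation: one class for products and inverses. *)
Inductive smooth_alg (f0 : D -> E) : (D -> E) -> Prop :=
| SmoothAlgBase f of smooth_on U f : smooth_alg f0 f
| SmoothAlgInv : smooth_alg f0 (fun x => ((f0 x)^-1)%VF)
| SmoothAlgAdd f g of smooth_alg f0 f & smooth_alg f0 g :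
    smooth_alg f0 (fun x => f x + g x)
| SmoothAlgComp f g of smooth_alg f0 f & smooth_alg f0 g :
    smooth_alg f0 (fun x => (f x \o g x)%VF).

Lemma smooth_algP f0 f : smooth_on U f0 ->
  (forall x, U x -> invertible (f0 x)) -> smooth_alg f0 f -> smooth_on U f.
Proof.
move=> f0U if0; apply: (smooth_coind oU) => {}f; elim=> {f}.
- move=> f fU; exists (fun x v => 'D_v f x) => [x Ux|v].
    exact: smooth_is_diff fU Ux.
  exact/SmoothAlgBase/smooth_derive.
- exists (fun x v => - ((f0 x)^-1 \o 'D_v f0 x \o (f0 x)^-1)%VF) => [x Ux|v].
    exact: is_diff_comp (smooth_is_diff f0U Ux) (is_diff_inv (if0 x Ux)).
  have -> : (fun x => - ((f0 x)^-1 \o 'D_v f0 x \o (f0 x)^-1)%VF) =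
      (fun x => (((f0 x)^-1 \o ((- \1) \o 'D_v f0 x)) \o (f0 x)^-1)%VF).
    by apply/funext => x; rewrite comp_lfunNl comp_lfun1l comp_lfunNr comp_lfunNl.
  apply: SmoothAlgComp; last exact: SmoothAlgInv.
  apply: SmoothAlgComp; first exact: SmoothAlgInv.
  apply: SmoothAlgComp; apply: SmoothAlgBase; first exact: smooth_cst.
  exact: smooth_derive.
- move=> f g _ [df fdf dfC] _ [dg gdg dgC].
  exists (fun x v => df x v + dg x v) => [x Ux|v]; last exact: SmoothAlgAdd.
  have := fdf x Ux; have := gdg x Ux => ? ?; exact: is_diffD.
- move=> f g fC [df fdf dfC] gC [dg gdg dgC].
  exists (fun x v => (f x \o dg x v)%VF + (df x v \o g x)%VF) => [x Ux|v].
    exact: is_diff_comp_lfun (fdf x Ux) (gdg x Ux).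
  by apply: SmoothAlgAdd; apply: SmoothAlgComp.
Qed.

Lemma smooth_comp_lfun f g : smooth_on U f -> smooth_on U g ->
  smooth_on U (fun x => (f x \o g x)%VF).
Proof.
move=> fU gU; apply: (@smooth_algP (fun=> \1%VF)).
- exact: smooth_cst.
- by move=> x _; apply: invertibleP => X; rewrite comp_lfun1l.
- by apply: SmoothAlgComp; exact: SmoothAlgBase.
Qed.

Lemma smooth_inv f : smooth_on U f -> (forall x, U x -> invertible (f x)) ->
  smooth_on U (fun x => ((f x)^-1)%VF).
Proof. by move=> fU fi; apply: (smooth_algP fU fi); exact: SmoothAlgInv. Qed.

End SmoothEnd.
End EndCalculus.

(** * The mean value inequality, and derivatives as endomorphisms *)

Section MeanValue.
Variables (R : realType) (U V : vectType R).

(** The mean value theorem applies to each matrix entry; the supremum norm then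
    recovers the bound without loss. *)
Lemma mean_value (f df : R -> 'Hom(U, V)) (b k : R) : 0 <= b ->
  (forall t : R, 0 <= t <= b -> is_diff t f (fun s => s *: df t) /\ `|df t| <= k) ->
  `|f b - f 0| <= k * b.
Proof.
move=> b0 fb.
have k0 : 0 <= k.
  by apply: le_trans (fb 0 _).2; rewrite ?normr_ge0// lexx.
apply: hom_norm_le => [|i j]; first exact: mulr_ge0.
have eC : continuous (mx_entry i j : 'Hom(U, V) -> R^o).
  exact/hom_linear_continuous/mx_entry_is_linear.
have fd (t : R) : 0 <= t <= b ->
    is_derive t 1 (mx_entry i j \o f : R -> R) (mx_entry i j (df t)).
  move=> /fb[ft _].
  have et : is_diff (f t) (mx_entry i j : 'Hom(U, V) -> R^o) (mx_entry i j).
    by split; [exact: linear_differentiable|exact: diff_lin].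
  have [d1 d2] := is_diff_comp ft et.
  split; first exact/derivable1_diffP.
  by rewrite deriveE// d2 /= scale1r.
have [||c cb] := @MVT_segment R (mx_entry i j \o f)
    (fun t => mx_entry i j (df t)) 0 b b0.
- by move=> t /subset_itv_oo_cc tb; apply: fd; move: tb; rewrite in_itv.
- apply: derivable_within_continuous => t; rewrite in_itv => /fd tb.
  by case: tb.
rewrite -linearB /= => ->.
rewrite subr0 normrM (ger0_norm b0) ler_wpM2r//.
apply: le_trans (mx_entry_le _ _ _) _.
by move: cb; rewrite in_itv => /fb[].
Qed.

End MeanValue.

Lemma eval_bounded (R : realType) (U1 V1 U2 V2 : vectType R) : exists2 k, 0 <= k &
  forall (f : 'Hom('Hom(U1, V1), 'Hom(U2, V2))) v, `|f v| <= k * `|f| * `|v|.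
Proof.
have ev u : exists2 k, 0 <= k &
    forall f : 'Hom('Hom(U1, V1), 'Hom(U2, V2)), `|f u| <= k * `|f|.
  by apply: hom_linear_bounded => a f g; rewrite add_lfunE scale_lfunE.
have {ev} /choice[k kP] : forall u, exists k, 0 <= k /\
    forall f : 'Hom('Hom(U1, V1), 'Hom(U2, V2)), `|f u| <= k * `|f|.
  by move=> u; have [k] := ev u; exists k.
exists (\sum_i \sum_j k (@hom_unit R U1 V1 i j)).
  apply: sumr_ge0 => i _; apply: sumr_ge0 => j _.
  by case: (kP (@hom_unit R U1 V1 i j)).
move=> f v; rewrite {1}(hom_unit_sum v) linear_sum !mulr_suml.
apply: le_trans (ler_norm_sum _ _ _) _; apply: ler_sum => i _.
rewrite linear_sum !mulr_suml.
apply: le_trans (ler_norm_sum _ _ _) _; apply: ler_sum => j _.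
have [_ kf] := kP (@hom_unit R U1 V1 i j).
rewrite linearZ normrZ mulrC; apply: ler_pM => //; [exact: kf|exact: mx_entry_le].
Qed.


Section Dop.
Variables (R : realType) (V : vectType R).
Local Notation E := 'End(V).

(** Packing the derivative as an endomorphism of the space of endomorphisms brings
    its inverse within the scope of smoothness of inversion. *)
Definition dop (f : E -> E) (x : E) : 'End(E) := linfun (fun v => 'D_v f x).

Lemma dopE f df x v : is_diff x f df -> dop f x v = df v.
Proof.
move=> fx; have dfL := is_diff_linear fx.
pose l : {linear _ -> _} := HB.pack df (GRing.isLinear.Build R _ _ _ _ dfL).
rewrite /dop (_ : (fun v => 'D_v f x) = l) ?lfunE//.
by apply/funext => w; rewrite (is_diff_derive w fx).
Qed.

Lemma smooth_dop (U : set E) (f : E -> E) : open U -> smooth_on U f ->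
  smooth_on U (dop f).
Proof.
move=> oU fU.
pose T i j (y : E) : 'End(E) := linfun (fun v : E => mx_entry i j v *: y).
have TE i j y v : T i j y v = mx_entry i j v *: y.
  have lL : linear (fun v : E => mx_entry i j v *: y).
    by move=> a u w; rewrite linearP scalerDl scalerA.
  pose l : {linear E -> E} := HB.pack (fun v : E => mx_entry i j v *: y)
    (GRing.isLinear.Build R _ _ _ _ lL).
  by rewrite /T -[X in linfun X]/(l : E -> E) lfunE.
apply: (smooth_ext oU (f := fun x =>
   \sum_i \sum_j T i j ('D_(@hom_unit R V V i j) f x))).
  move=> x Ux; apply/lfunP => v; have fx := smooth_is_diff fU Ux.
  rewrite (dopE v fx) sum_lfunE {2}(hom_unit_sum v).
  have [fd _] := fx; rewrite (deriveE _ fd) linear_sum; apply: eq_bigr => i _.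
  rewrite sum_lfunE linear_sum; apply: eq_bigr => j _.
  by rewrite linearZ TE deriveE.
apply: smooth_sum => // i; apply: smooth_sum => // j.
apply: (@smooth_linear_comp _ _ _ _ _ (T i j)) => //.
- move=> a y z; apply/lfunP => v.
  by rewrite add_lfunE scale_lfunE !TE scalerDr scalerA mulrC -scalerA.
- apply: hom_linear_continuous => a y z; apply/lfunP => v.
  by rewrite add_lfunE scale_lfunE !TE scalerDr scalerA mulrC -scalerA.
- exact: smooth_derive.
Qed.

End Dop.

(** * The inverse function theorem *)

Section InverseFunction.
Variables (R : realType) (V : vectType R).
Local Notation E := 'End(V).
Variables (Psi : E -> E) (r : R).
Hypothesis r0 : 0 < r.
Local Notation B := [set x : E | `|x| < r].
Hypothesis PsiU : smooth_on [set x : E | `|x| < 2 * r] Psi.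
Hypothesis dPsi : forall x v : E, `|x| < 2 * r -> `|'D_v Psi x - v| <= 2^-1 * `|v|.

Let oball (s : R) : open [set x : E | `|x| < s].
Proof.
rewrite (_ : [set x | _] = ball (0 : E) s); first exact: ball_open.
by apply/seteqP; split=> x; rewrite -ball_normE /= sub0r normrN.
Qed.

Let Psi_diff (x : E) : `|x| < 2 * r -> is_diff x Psi (fun v => 'D_v Psi x).
Proof. exact: (smooth_is_diff PsiU). Qed.

Let le_2r (x : E) : `|x| <= r -> `|x| < 2 * r.
Proof. by move=> /le_lt_trans; apply; rewrite ltr_pMl// ltr1n. Qed.

Let displacement_contracts (x y : E) : `|x| <= r -> `|y| <= r ->
  `|(Psi x - x) - (Psi y - y)| <= 2^-1 * `|x - y|.
Proof.
move=> xr yr.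
pose f (t : R) := Psi (t *: (x - y) + y) - (t *: (x - y) + y).
have -> : (Psi x - x) - (Psi y - y) = f 1 - f 0.
  by rewrite /f !scale1r !scale0r !add0r !subrK.
rewrite -[leRHS]mulr1; apply: (@mean_value _ _ _ f
  (fun t => 'D_(x - y) Psi (t *: (x - y) + y) - (x - y))) => // t /andP[t0 t1].
have xyr : `|t *: (x - y) + y| < 2 * r.
  have -> : t *: (x - y) + y = t *: x + (1 - t) *: y.
    by rewrite scalerBr scalerBl scale1r -addrA [- _ + _]addrC.
  apply: le_2r.
  apply: le_trans (ler_normD _ _) _; rewrite !normrZ ger0_norm//.
  rewrite ger0_norm ?subr_ge0//.
  rewrite [leRHS](_ : r = t * r + (1 - t) * r); last by ring.
  by apply: lerD; rewrite ler_wpM2l// subr_ge0.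
split; last exact: dPsi.
apply: (@is_diff_line _ _ _ (fun z => Psi z - z) (fun v => 'D_v Psi _ - v)).
have h1 := Psi_diff xyr.
exact: is_diffB.
Qed.

Let Psi_expands (x y : E) : `|x| <= r -> `|y| <= r ->
  `|x - y| <= 2 * `|Psi x - Psi y|.
Proof.
move=> xr yr; have := displacement_contracts xr yr.
have -> : Psi x - x - (Psi y - y) = (Psi x - Psi y) - (x - y).
  by rewrite !opprB [y - _]addrC addrACA [- x + _]addrC.
have := ler_normB (Psi x - Psi y) ((Psi x - Psi y) - (x - y)).
by rewrite opprB addrCA subrr addr0; lra.
Qed.

Lemma dop_invertible (x : E) : `|x| < 2 * r -> invertible (dop Psi x).
Proof.
move=> xr; apply/eqP/lker0P => u v; rewrite !(dopE _ (Psi_diff xr)) => uv.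
have : 'D_(u - v) Psi x = 0.
  have [dx _] := Psi_diff xr; rewrite deriveE// linearB /=.
  by rewrite -!deriveE// uv subrr.
move=> D0; have := dPsi (u - v) xr; rewrite D0 sub0r normrN => uv2.
apply/eqP; rewrite -subr_eq0 -normr_le0; have := normr_ge0 (u - v); lra.
Qed.

Lemma Psi_preimage (y : E) : `|y - Psi 0| < r / 2 -> exists2 x, `|x| < r & Psi x = y.
Proof.
move=> yr; pose f (x : E) := y - (Psi x - x).
have f_le (x : E) : `|x| <= r -> `|f x| <= `|y - Psi 0| + 2^-1 * `|x|.
  move=> xr; have := @displacement_contracts x 0 xr.
  rewrite normr0 => /(_ (ltW r0)); rewrite !subr0 => h.
  have -> : f x = (y - Psi 0) - (Psi x - x - Psi 0).
    by rewrite [in RHS]opprB addrA subrK.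
  by apply: le_trans (ler_normB _ _) _; rewrite lerD2l.
pose U := closed_ball (0 : E) r.
have UE (x : E) : U x <-> `|x| <= r.
  by rewrite /U closed_ballE// /closed_ball_ /= sub0r normrN.
have fU : set_fun U U f.
  move=> x /UE xr; apply/UE; apply: le_trans (f_le x xr) _; lra.
pose F : {fun U >-> U} := HB.pack f (isFun.Build _ _ U U f fU).
have [||/=|x /UE xr xE] := @banach_fixed_point R E U F.
- exists (2^-1)%:nng; split=> /=; first lra.
  move=> -[x z] /= [/UE xr /UE zr].
  rewrite -[X in `|X|]/(y - (Psi x - x) - (y - (Psi z - z))).
  rewrite [X in `|X|](_ : _ = - ((Psi x - x) - (Psi z - z))).
    by rewrite normrN; exact: displacement_contracts.
  move: (Psi x - x) (Psi z - z) => a b.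
  by rewrite opprB [y - a]addrC addrACA subrr addr0 opprB addrC.
- exact: closed_ball_closed.
- by exists 0; apply/UE; rewrite normr0 ltW.
have {}xE : x = f x by [].
exists x; first by have := f_le x xr; rewrite -xE; lra.
by rewrite -[RHS](subrK (Psi x - x)) -/(f x) -xE addrC subrK.
Qed.

Let Phi (y : E) : E := xget 0 [set x | `|x| < r /\ Psi x = y].
Local Notation W := [set y : E | `|y - Psi 0| < r / 2].

Let PhiP (y : E) : W y -> `|Phi y| < r /\ Psi (Phi y) = y.
Proof.
move=> /Psi_preimage[x xr <-].
exact: (@xgetPex _ 0 [set z : E | `|z| < r /\ Psi z = Psi x]
  (ex_intro _ x (conj xr erefl))).
Qed.

Let PhiK (x : E) : `|x| < r -> W (Psi x) -> Phi (Psi x) = x.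
Proof.
move=> xr /PhiP[Pr PE]; have := Psi_expands (ltW Pr) (ltW xr).
by rewrite PE subrr normr0 mulr0 normr_le0 subr_eq0 => /eqP.
Qed.

Let W_open : open W.
Proof.
rewrite (_ : [set x | _] = ball (Psi 0) (r / 2)); first exact: ball_open.
by apply/seteqP; split=> x; rewrite -ball_normE /= distrC.
Qed.

Let Phi_diff (y : E) : W y ->
  is_diff y Phi (fun h => (dop Psi (Phi y))^-1%VF h).
Proof.
move=> Wy; have [xr Pxy] := PhiP Wy; set x := Phi y in xr Pxy *.
have x2r : `|x| < 2 * r by apply: le_2r; exact: ltW.
have iM := dop_invertible x2r; set M := dop Psi x in iM *.
have [c c0 Mc] := @hom_linear_bounded R V V E (M^-1)%VF (linearP _).
apply: is_diffI => [|| e e0]; first exact: linearP.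
  by apply: hom_linear_continuous; exact: linearP.
have e'0 : 0 < e / (2 * (c + 1)) by rewrite divr_gt0// mulr_gt0// ltr_wpDl.
have := is_diff_near (Psi_diff x2r) e'0.
move=> /nbhs_norm0P[s /= s0 Ps].
have nW : \forall h \near (0 : E), W (h + y).
  have : nbhs y W by exact: open_nbhs_nbhs.
  rewrite -[nbhs y W]/(\forall z \near y, W z) (near_shift 0) /= subr0.
  by apply: filterS.
have ns : \forall h \near (0 : E), `|h| < s / 2.
  by apply/nbhs_norm0P; exists (s / 2) => //=; rewrite divr_gt0.
apply: filterS2 nW ns => h Wh hs.
have [zr Pz] := PhiP Wh; set z := Phi (h + y) in zr Pz *.
have kh : `|z - x| <= 2 * `|h|.
  have := Psi_expands (ltW zr) (ltW xr).
  by rewrite Pz Pxy addrK.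
have := Ps (z - x); rewrite /= subrK Pz Pxy addrK => /(_ _).
have -> : z - x - (M^-1)%VF h = - (M^-1)%VF (h - 'D_(z - x) Psi x).
  rewrite linearB /= opprB; congr (_ - _).
  rewrite -(dopE _ (Psi_diff x2r)) -/M.
  by rewrite -comp_lfunE comp_Vlfun// id_lfunE.
rewrite normrN => hk; apply: le_trans (Mc _) _.
apply: (@le_trans _ _ (c * (e / (2 * (c + 1)) * (2 * `|h|)))).
  rewrite ler_wpM2l//; apply: le_trans (hk _) _; first lra.
  by rewrite ler_wpM2l// ltW.
have -> : c * (e / (2 * (c + 1)) * (2 * `|h|)) = c / (c + 1) * (e * `|h|).
  field; lra.
apply: ler_piMl; first by rewrite mulr_ge0// ltW.
rewrite ler_pdivrMr; lra.
Qed.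

Let Phi_smooth : smooth_on W Phi.
Proof.
have oB : open B := @oball r.
have BU : B `<=` [set x : E | `|x| < 2 * r].
  by move=> x /ltW /le_2r.
pose C (h : E -> E) := exists2 u, smooth_on B u & h = u \o Phi.
refine (@smooth_coind _ _ _ _ W_open C _ _ _); last first.
  exists id => //; apply: smooth_linear => //.
  by move=> x.
move=> _ [u uB ->].
exists (fun y v => 'D_((dop Psi (Phi y))^-1%VF v) u (Phi y)) => [y Wy|v].
  apply: is_diff_comp (Phi_diff Wy) _.
  by have [xr _] := PhiP Wy; exact: smooth_is_diff uB xr.
exists (fun x => 'D_((dop Psi x)^-1%VF v) u x) => //.
apply: (smooth_ext oB (f := fun x => (dop u x \o (dop Psi x)^-1)%VF v)).
  by move=> x Bx; rewrite comp_lfunE (dopE _ (smooth_is_diff uB Bx)).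
have evL : linear (fun f : 'End(E) => f v).
  by move=> a f g; rewrite add_lfunE scale_lfunE.
apply: (@smooth_linear_comp _ _ _ _ _ (fun f : 'End(E) => f v)) => //.
  exact: hom_linear_continuous.
apply: smooth_comp_lfun => //; first exact: smooth_dop.
apply: smooth_inv => //; last first.
  by move=> x /BU; exact: dop_invertible.
by apply: smooth_dop => //; apply: smooth_sub PsiU.
Qed.

(** Here the derivative of [Psi] stays within one half of the identity on a
    ball; the displacement [Psi x - x] is then a contraction, so that points
    near [Psi 0] have unique preimages. *)
Theorem inverse_function : exists Phi : E -> E,
  [/\ open W, smooth_on W Phi,
      forall y, W y -> `|Phi y| < r /\ Psi (Phi y) = y &
      forall x, `|x| < r -> W (Psi x) -> Phi (Psi x) = x].
Proof. by exists Phi. Qed.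

End InverseFunction.

(** * Algebra of skew endomorphisms *)

Section SkewAlgebra.
Variables (R : realType) (V : vectType R) (g : {dot V for idfun}).
Local Notation E := 'End(V).
Local Notation "A ** B" := (comp_lfun A B) (at level 40, left associativity).
Implicit Types A B C K L X Y Z P : E.

Lemma gC u v : g u v = g v u.
Proof. by rewrite hermC expr0 mul1r. Qed.

Lemma g_eq0 u : g u u = 0 -> u = 0.
Proof.
move=> gu0; apply/eqP; apply: contra_eqT gu0 => u0.
by rewrite gt_eqF// neq0_dnorm_gt0.
Qed.

Lemma gDl u v w : g (u + v) w = g u w + g v w. Proof. exact: linearDl. Qed.
Lemma gNl u v : g (- u) v = - g u v. Proof. exact: linearNl. Qed.
Lemma gZl a u v : g (a *: u) v = a * g u v. Proof. exact: linearZl_LR. Qed.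
Lemma gDr u v w : g w (u + v) = g w u + g w v. Proof. exact: linearDr. Qed.
Lemma gNr u v : g v (- u) = - g v u. Proof. exact: linearNr. Qed.
Lemma gZr a u v : g v (a *: u) = a * g v u.
Proof. by rewrite gC gZl gC. Qed.
Lemma g0l u : g 0 u = 0. Proof. exact: linear0l. Qed.
Lemma g0r u : g u 0 = 0. Proof. exact: linear0r. Qed.

(** Pairing with [g] turns an identity between endomorphisms into one between
    scalars, where [ring] applies. *)
Lemma g_ext A B : (forall u v, g (A u) v = g (B u) v) -> A = B.
Proof.
move=> AB; apply/lfunP => u; apply/eqP; rewrite -subr_eq0; apply/eqP/g_eq0.
by rewrite gDl gNl AB subrr.
Qed.

Lemma comm_lfunE A B v : comm_lfun A B v = A (B v) - B (A v).
Proof. by rewrite add_lfunE opp_lfunE !comp_lfunE. Qed.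

Lemma lfunD A u v : A (u + v) = A u + A v. Proof. exact: linearD. Qed.
Lemma lfunN A u : A (- u) = - A u. Proof. exact: linearN. Qed.
Lemma lfunZ A a u : A (a *: u) = a *: A u. Proof. exact: linearZ. Qed.
Lemma lfun0 A : A 0 = 0. Proof. exact: linear0. Qed.

Definition lfE := (lfunD, lfunN, lfunZ, lfun0, comm_lfunE, comp_lfunE,
  add_lfunE, opp_lfunE, scale_lfunE, id_lfunE, zero_lfunE).
Definition gE := (gDl, gNl, gZl, gDr, gNr, gZr, g0l, g0r).

Lemma twistorE K : twistor g K <-> K ** K = - \1%VF /\ ortho_alg g K.
Proof.
split=> -[K2 gK]; split=> // u v.
  by rewrite -gK -comp_lfunE K2 opp_lfunE id_lfunE gNl.
by rewrite gK -[K (K v)]comp_lfunE K2 !lfE gNr opprK.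
Qed.

Lemma twistorK K v : twistor g K -> K (K v) = - v.
Proof. by move=> [K2 _]; rewrite -comp_lfunE K2 !lfE. Qed.

(** The Lie algebra that moves the points of a leaf: skew endomorphisms commuting
    with the members of [G], where [G] is empty for the first distribution and
    [[set J]] for the second. *)
Definition skew_centralizer (G : set E) : set E :=
  [set A | ortho_alg g A /\ forall X, G X -> A ** X = X ** A].

Lemma skew_centralizer_lin G a A B : skew_centralizer G A ->
  skew_centralizer G B -> skew_centralizer G (a *: A + B).
Proof.
move=> [Ao AG] [Bo BG]; split=> [u v|X GX].
  by rewrite !lfE !gE (Ao u v) (Bo u v) opprD mulrN.
by rewrite comp_lfunDl comp_lfunDr -comp_lfunZl -comp_lfunZr AG// BG.
Qed.

Lemma comm_lfun_lin K a A B :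
  comm_lfun (a *: A + B) K = a *: comm_lfun A K + comm_lfun B K.
Proof. by apply: g_ext => u v; rewrite !(lfE, gE); ring. Qed.

Lemma comm_ortho_anti K A : twistor g K -> ortho_alg g A ->
  ortho_anti g K (comm_lfun A K).
Proof.
move=> Kt Ao; have [K2 Ko] := (twistorE K).1 Kt; split=> [u v|].
  by rewrite !(lfE, gE) (Ao (K u)) (Ko u) (Ko (A u)) (Ao u); ring.
apply/lfunP => u; rewrite !lfE !(twistorK _ Kt) lfunN.
by rewrite addrA subrK addrN.
Qed.

(** Every tangent vector to the twistor space is the velocity of a conjugation:
    as [A] anticommutes with [K], the generator is [- A K / 2]. *)
Lemma ortho_anti_comm K A : twistor g K -> ortho_anti g K A ->
  ortho_alg g (- 2^-1 *: (A ** K)) /\ A = comm_lfun (- 2^-1 *: (A ** K)) K.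
Proof.
move=> Kt [Ao AK]; have [K2 Ko] := (twistorE K).1 Kt.
have AKv v : A (K v) = - K (A v).
  apply/eqP; rewrite -addr_eq0 -!comp_lfunE -add_lfunE AK zero_lfunE.
  by [].
split=> [u v|]; first by rewrite !(lfE, gE) Ao Ko AKv gNr; ring.
apply/lfunP => v; rewrite !lfE !(twistorK _ Kt) AKv !lfE !(twistorK _ Kt).
rewrite !scaleNr !scalerN !opprK -scalerDl -[LHS]scale1r; congr (_ *: _); lra.
Qed.

Section NormalOperator.
(** [P] is symmetric or skew; its kernel and image are then orthogonal
    complements. *)
Variables (P : E) (s : R).
Hypothesis Ps : forall u v, g (P u) v = s * g u (P v).

Lemma ker_im_direct : (lker P + limg P = fullv)%VS /\ (lker P :&: limg P = 0)%VS.
Proof.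
have cap0 : (lker P :&: limg P = 0)%VS.
  apply/eqP; rewrite -subv0; apply/subvP => v.
  rewrite memv_cap memv_ker => /andP[/eqP Pv /memv_imgP[u _ vE]].
  rewrite memv0; apply/eqP/g_eq0.
  by rewrite {1}vE Ps Pv g0r mulr0.
split=> //; apply/eqP; rewrite eqEdim subvf /= dimv_disjoint_sum//.
by rewrite -(limg_ker_dim P fullv) capfv.
Qed.

Definition ker_proj : E := daddv_pi (lker P) (limg P).

Lemma ker_proj_ker v : P (ker_proj v) = 0.
Proof. by apply/eqP; rewrite -memv_ker memv_pi. Qed.

Lemma ker_proj_id v : P v = 0 -> ker_proj v = v.
Proof.
by move=> Pv; apply: daddv_pi_id; [case: ker_im_direct|rewrite memv_ker Pv].
Qed.

Lemma ker_proj_im v : exists u, v = ker_proj v + P u.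
Proof.
have [sum cap] := ker_im_direct.
have := @daddv_pi_add _ _ (lker P) (limg P) v cap; rewrite sum memvf => /(_ isT).
move=> vE; have /memv_imgP[u _ uE] := memv_pi (limg P) (lker P) v.
by exists u; rewrite -uE /ker_proj vE.
Qed.

Lemma g_ker_im u v : P u = 0 -> g u (P v) = 0.
Proof. by move=> Pu; rewrite gC Ps Pu g0r mulr0. Qed.

Lemma ker_proj_sym u v : g (ker_proj u) v = g u (ker_proj v).
Proof.
have [u' uE] := ker_proj_im u; have [v' vE] := ker_proj_im v.
rewrite {1}vE gDr (g_ker_im _ (ker_proj_ker u)) addr0.
by rewrite {2}uE gDl [g (P u') _]gC (g_ker_im _ (ker_proj_ker v)) addr0.
Qed.

Lemma ker_projK : ker_proj ** ker_proj = ker_proj.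
Proof. by apply/lfunP => v; rewrite comp_lfunE ker_proj_id// ker_proj_ker. Qed.

Lemma comp_ker_proj : P ** ker_proj = 0.
Proof. by apply/lfunP => v; rewrite !lfE ker_proj_ker. Qed.

Lemma ker_proj_comp : ker_proj ** P = 0.
Proof.
apply: g_ext => u v.
by rewrite !lfE ker_proj_sym gC (g_ker_im _ (ker_proj_ker v)) g0l.
Qed.

(** The orthogonal complement of a stable subspace is stable under a skew
    endomorphism. *)
Lemma skew_ker_stable_comm X : ortho_alg g X -> (forall v, P v = 0 -> P (X v) = 0) ->
  X ** ker_proj = ker_proj ** X.
Proof.
move=> Xo XP.
have X1 v : X (ker_proj v) = ker_proj (X (ker_proj v)).
  by rewrite [RHS]ker_proj_id// XP// ker_proj_ker.
apply: g_ext => u v; rewrite !lfE X1 ker_proj_sym Xo ker_proj_sym.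
by rewrite -X1 -Xo -ker_proj_sym.
Qed.

(** For skew [A] the two conditions on the kernel and on the image of [P] reduce
    to the first, by orthogonality. *)
Lemma ker_im_compatE A : ortho_alg g A ->
  ker_im_compat P A <-> forall v, P v = 0 -> A v = 0.
Proof.
move=> Ao; split=> [[/eqP Ak _] v Pv|Ak].
  move: Ak; rewrite -lkerE => /subvP/(_ v); rewrite memv_ker Pv eqxx => /(_ isT).
  by rewrite memv_ker => /eqP.
split.
  apply/eqP; rewrite -lkerE; apply/subvP => v; rewrite !memv_ker => /eqP/Ak ->.
  by [].
apply/subvP => v /memv_imgP[u _ ->].
have [w Auw] := ker_proj_im (A u).
suff p0 : ker_proj (A u) = 0 by rewrite Auw p0 add0r memv_img// memvf.
apply: g_eq0; rewrite ker_proj_sym ker_proj_id ?ker_proj_ker// Ao.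
by rewrite Ak ?g0r ?oppr0// ker_proj_ker.
Qed.

End NormalOperator.

End SkewAlgebra.

(** * Conjugation by Cayley transforms *)

Section Cayley.
Variables (R : realType) (V : vectType R) (g : {dot V for idfun}).
Local Notation E := 'End(V).
Local Notation "A ** B" := (comp_lfun A B) (at level 40, left associativity).
Implicit Types A B C K L X Y Z P : E.

(** The resolvent of [Y] at [1], and the Cayley transform [(1 + Y)(1 - Y)^-1] in a
    form with a single factor to differentiate. *)
Definition res Y : E := ((\1 - Y)^-1)%VF.
Definition cay Y : E := 2 *: res Y - \1%VF.

(** The orbit map of the conjugation action, in the coordinates of the Cayley
    transform; unlike the exponential it is rational. *)
Definition orb K B : E := cay (2^-1 *: B) ** K ** cay (- 2^-1 *: B).

Lemma skew_scale a B : ortho_alg g B -> ortho_alg g (a *: B).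
Proof. by move=> Bo u v; rewrite !lfE !gE Bo mulrN. Qed.

Lemma skew_res_inv Y : ortho_alg g Y -> invertible (\1%VF - Y).
Proof.
move=> Yo; apply: invertibleP => X X0.
have YX v : X v = Y (X v).
  apply/eqP; rewrite -subr_eq0 -[X in X - _](id_lfunE (X v)).
  by rewrite -opp_lfunE -add_lfunE -comp_lfunE X0 zero_lfunE.
apply/lfunP => v; rewrite zero_lfunE; apply: (@g_eq0 _ _ g).
have := Yo (X v) (X v); rewrite -YX; lra.
Qed.

Lemma resl Y : ortho_alg g Y -> res Y ** (\1%VF - Y) = \1%VF.
Proof. by move=> /skew_res_inv; exact: comp_Vlfun. Qed.

Lemma resr Y : ortho_alg g Y -> (\1%VF - Y) ** res Y = \1%VF.
Proof. by move=> /skew_res_inv; exact: comp_lfunV. Qed.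

Lemma skew_opp Y : ortho_alg g Y -> ortho_alg g (- Y).
Proof. by move=> Yo; rewrite -scaleN1r; exact: skew_scale. Qed.

Lemma res_comm X Y : ortho_alg g Y -> X ** Y = Y ** X -> X ** res Y = res Y ** X.
Proof.
move=> Yo XY; rewrite -[X in X ** _](comp_lfun1l X) -(resl Yo).
rewrite -!comp_lfunA [in X in _ ** X]comp_lfunA.
have -> : (\1%VF - Y) ** X = X ** (\1%VF - Y).
  by rewrite comp_lfunDl comp_lfunDr comp_lfunNl comp_lfunNr XY comp_lfun1l
    comp_lfun1r.
by rewrite -comp_lfunA resr// comp_lfun1r.
Qed.

Lemma res_adj Y u v : ortho_alg g Y -> g (res Y u) v = g u (res (- Y) v).
Proof.
move=> Yo; have Y'o := skew_opp Yo.
have uE : u = (\1%VF - Y) (res Y u) by rewrite -comp_lfunE resr// id_lfunE.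
have vE : v = (\1%VF - - Y) (res (- Y) v) by rewrite -comp_lfunE resr// id_lfunE.
rewrite {1}vE {2}uE; move: (res Y u) (res (- Y) v) => a b.
by rewrite !lfE !gE Yo; ring.
Qed.

Lemma cayE Y : ortho_alg g Y ->
  cay Y = res Y ** (\1%VF + Y) /\ cay Y = (\1%VF + Y) ** res Y.
Proof.
move=> Yo; rewrite /cay.
have -> : \1%VF + Y = 2 *: \1%VF - (\1%VF - Y).
  by apply: (@g_ext _ _ g) => u v; rewrite !lfE !gE; ring.
split.
- by rewrite comp_lfunDr comp_lfunNr resl// -comp_lfunZr comp_lfun1r.
- by rewrite comp_lfunDl comp_lfunNl resr// -comp_lfunZl comp_lfun1l.
Qed.

Lemma resN_cay Y : ortho_alg g Y -> res (- Y) ** cay Y = res Y.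
Proof.
move=> Yo; rewrite (cayE Yo).2 comp_lfunA.
by rewrite -[X in \1%VF + X]opprK resl ?comp_lfun1l//; exact: skew_opp.
Qed.

Lemma cayN_res Y : ortho_alg g Y -> cay (- Y) ** res Y = res (- Y).
Proof.
move=> Yo; have Y'o := skew_opp Yo; rewrite (cayE Y'o).1 -comp_lfunA.
by rewrite resr// comp_lfun1r.
Qed.

Lemma cayK Y : ortho_alg g Y -> cay Y ** cay (- Y) = \1%VF.
Proof.
move=> Yo; have Y'o := skew_opp Yo; rewrite (cayE Yo).1 (cayE Y'o).2.
rewrite -comp_lfunA [X in res Y ** X]comp_lfunA.
have -> : (\1%VF + Y) ** (\1%VF - Y) = (\1%VF - Y) ** (\1%VF + Y).
  by apply: (@g_ext _ _ g) => u v; rewrite !lfE !gE; ring.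
rewrite -comp_lfunA -[X in _ ** (_ ** (X ** _))]opprK.
have -> : - - (\1%VF + Y) = \1%VF - - Y by rewrite !opprK.
by rewrite resr// comp_lfun1r resl.
Qed.

Lemma cay_adj Y u v : ortho_alg g Y -> g (cay Y u) v = g u (cay (- Y) v).
Proof. by move=> Yo; rewrite /cay !lfE !gE res_adj. Qed.

(** The generator: the logarithmic derivative of the Cayley transform at [B / 2]
    in the direction [Z / 2]. *)
Definition gen B Z : E := res (2^-1 *: B) ** Z ** res (- (2^-1 *: B)).

Lemma gen0 Z : gen 0 Z = Z.
Proof.
have r0 : res 0 = \1%VF.
  rewrite -[LHS]comp_lfun1r -[X in _ ** X](subr0 \1%VF) resl// => u v.
  by rewrite !lfE !gE oppr0.
by rewrite /gen scaler0 oppr0 r0 comp_lfun1l comp_lfun1r.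
Qed.

Lemma is_diff_cay Y : ortho_alg g Y ->
  is_diff Y cay (fun Z => 2 *: (res Y ** Z ** res Y)).
Proof.
move=> Yo.
have oneC : is_diff Y (fun X => - X + \1%VF) (fun Z => - Z).
  apply: is_diff_affine => [a u v|x]; first by rewrite opprD scalerN.
  exact: opp_continuous.
have i1 : invertible (- Y + \1%VF) by rewrite addrC; exact: skew_res_inv.
have cC : is_diff ((- Y + \1)^-1)%VF (fun X : E => 2 *: X - \1%VF) ( *:%R 2).
  apply: is_diff_affine => [a u v|]; first by rewrite scalerDr !scalerA mulrC.
  exact: scaler_continuous.
have h := is_diff_comp (is_diff_comp oneC (is_diff_inv i1)) cC.
have -> : cay = (fun X : E => 2 *: X - \1%VF) \o
    ((fun B : E => (B^-1)%VF) \o (fun X => - X + \1%VF)).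
  by apply/funext => X; rewrite /cay /res /= [- X + _]addrC.
have -> : (fun Z => 2 *: (res Y ** Z ** res Y)) = ( *:%R 2) \o
    ((fun H => - ((- Y + \1)^-1 \o H \o (- Y + \1)^-1)%VF) \o (fun Z : E => - Z)).
  apply/funext => Z /=; rewrite comp_lfunNr comp_lfunNl opprK.
  by rewrite /res [\1%VF - Y]addrC.
exact: h.
Qed.

(** The velocity of the orbit map is the commutator with the generator, so the
    orbit map moves along the infinitesimal action. *)
Lemma is_diff_orb K B : ortho_alg g B ->
  is_diff B (orb K) (fun Z => comm_lfun (gen B Z) (orb K B)).
Proof.
move=> Bo; pose Y := 2^-1 *: B; have Yo : ortho_alg g Y by exact: skew_scale.
have Y'o := skew_opp Yo.
have half (a : R) : is_diff B (fun X : E => a *: X + 0) ( *:%R a).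
  apply: is_diff_affine => [b u v|]; first by rewrite scalerDr !scalerA mulrC.
  exact: scaler_continuous.
have c1 : is_diff B (fun X => cay (2^-1 *: X)) (fun Z => res Y ** Z ** res Y).
  have := half 2^-1 => h1.
  have h2 : is_diff (2^-1 *: B + 0) cay (fun Z => 2 *: (res Y ** Z ** res Y)).
    by rewrite addr0; exact: is_diff_cay.
  have := is_diff_comp h1 h2.
  have -> : cay \o (fun X => 2^-1 *: X + 0) = (fun X => cay (2^-1 *: X)).
    by apply/funext => X /=; rewrite addr0.
  have -> // : (fun Z => 2 *: (res Y ** Z ** res Y)) \o *:%R 2^-1 =
    (fun Z => res Y ** Z ** res Y).
  apply/funext => Z /=; rewrite -comp_lfunZr -comp_lfunZl scalerA.
  by rewrite divff ?scale1r.
have c2 : is_diff B (fun X => cay (- 2^-1 *: X))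
    (fun Z => - (res (- Y) ** Z ** res (- Y))).
  have h2 : is_diff (- 2^-1 *: B + 0) cay
      (fun Z => 2 *: (res (- Y) ** Z ** res (- Y))).
    by rewrite addr0 scaleNr; exact: is_diff_cay.
  have := is_diff_comp (half (- 2^-1)) h2.
  have -> : cay \o (fun X => - 2^-1 *: X + 0) = (fun X => cay (- 2^-1 *: X)).
    by apply/funext => X /=; rewrite addr0.
  have -> // : (fun Z => 2 *: (res (- Y) ** Z ** res (- Y))) \o *:%R (- 2^-1) =
    (fun Z => - (res (- Y) ** Z ** res (- Y))).
  apply/funext => Z /=; rewrite -comp_lfunZr -comp_lfunZl scalerA.
  by rewrite mulrN divff ?scaleN1r.
have cK : is_diff B (fun=> K) (fun=> 0) by exact: is_diff_cst.
have := is_diff_comp_lfun (is_diff_comp_lfun c1 cK) c2.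
congr (is_diff_def _ _ _); apply/funext => Z.
have rc (W : E) : res (- Y) ** (cay Y ** W) = res Y ** W.
  by rewrite comp_lfunA resN_cay.
have cr (W : E) : cay (- Y) ** (res Y ** W) = res (- Y) ** W.
  by rewrite comp_lfunA cayN_res.
rewrite comp_lfun0r add0r /comm_lfun addrC /orb /gen -/Y scaleNr -/Y; congr (_ + _).
  by rewrite -!comp_lfunA rc.
by rewrite comp_lfunNr -!comp_lfunA cr.
Qed.

Lemma skew_gen B Z : ortho_alg g B -> ortho_alg g Z -> ortho_alg g (gen B Z).
Proof.
move=> Bo Zo u v; have Yo : ortho_alg g (2^-1 *: B) by exact: skew_scale.
rewrite !lfE res_adj// Zo res_adj; last exact: skew_opp.
by rewrite opprK.
Qed.

Lemma gen_comm X B Z : ortho_alg g B -> X ** B = B ** X -> X ** Z = Z ** X ->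
  X ** gen B Z = gen B Z ** X.
Proof.
move=> Bo XB XZ; have Yo : ortho_alg g (2^-1 *: B) by exact: skew_scale.
have XY : X ** (2^-1 *: B) = (2^-1 *: B) ** X.
  by rewrite -comp_lfunZr -comp_lfunZl XB.
have X'Y : X ** (- (2^-1 *: B)) = (- (2^-1 *: B)) ** X.
  by rewrite comp_lfunNr comp_lfunNl XY.
rewrite /gen !comp_lfunA (res_comm Yo XY) -[_ ** X ** Z]comp_lfunA XZ.
by rewrite -!comp_lfunA (res_comm (skew_opp Yo) X'Y) !comp_lfunA.
Qed.

Lemma cay_comm X Y : ortho_alg g Y -> X ** Y = Y ** X -> X ** cay Y = cay Y ** X.
Proof.
move=> Yo XY; rewrite /cay !comp_lfunDr !comp_lfunDl comp_lfunNr comp_lfunNl.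
by rewrite -comp_lfunZr -comp_lfunZl (res_comm Yo XY) comp_lfun1l comp_lfun1r.
Qed.

Lemma res_kill Y (p : E) : ortho_alg g Y -> Y ** p = 0 -> res Y ** p = p.
Proof.
move=> Yo Yp; have {1}-> : p = (\1%VF - Y) ** p.
  by rewrite comp_lfunDl comp_lfunNl Yp subr0 comp_lfun1l.
by rewrite comp_lfunA resl// comp_lfun1l.
Qed.

Lemma cay_kill Y (p : E) : ortho_alg g Y -> Y ** p = 0 -> cay Y ** p = p.
Proof.
move=> Yo Yp; rewrite /cay comp_lfunDl comp_lfunNl comp_lfun1l -comp_lfunZl.
by rewrite res_kill// scaler_nat mulr2n addrK.
Qed.

Lemma gen_kill B Z (p : E) : ortho_alg g B -> B ** p = 0 -> Z ** p = 0 ->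
  gen B Z ** p = 0.
Proof.
move=> Bo Bp Zp; have Yo := skew_scale (2^-1) Bo.
have Y'p : (- (2^-1 *: B)) ** p = 0.
  by rewrite comp_lfunNl -comp_lfunZl Bp scaler0 oppr0.
rewrite /gen -comp_lfunA (res_kill (skew_opp Yo) Y'p) -comp_lfunA Zp.
by rewrite comp_lfun0r.
Qed.

Lemma skew_killC A (p : E) : ortho_alg g A -> (forall u v, g (p u) v = g u (p v)) ->
  A ** p = 0 -> p ** A = 0.
Proof.
move=> Ao ps Ap; apply: (@g_ext _ _ g) => u v.
by rewrite !lfE ps Ao -comp_lfunE Ap !lfE !gE oppr0.
Qed.

Lemma cayVK Y : ortho_alg g Y -> cay (- Y) ** cay Y = \1%VF.
Proof. by move=> Yo; rewrite -{2}[Y]opprK cayK//; exact: skew_opp. Qed.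

Lemma cay0 : cay 0 = \1%VF.
Proof.
have o0 : ortho_alg g 0 by move=> u v; rewrite !lfE !gE oppr0.
by rewrite -[LHS]comp_lfun1r cay_kill// comp_lfun0l.
Qed.

Lemma orb0 K : orb K 0 = K.
Proof. by rewrite /orb !scaler0 cay0 comp_lfun1l comp_lfun1r. Qed.

Section Orbit.
Variables (K B : E).
Hypothesis Bo : ortho_alg g B.
Let Y := 2^-1 *: B.
Let Yo : ortho_alg g Y. Proof. exact: skew_scale. Qed.
Let Y'o : ortho_alg g (- Y). Proof. exact: skew_opp. Qed.

Let orbE : orb K B = cay Y ** K ** cay (- Y).
Proof. by rewrite /orb scaleNr. Qed.

Lemma orb_twistor : twistor g K -> twistor g (orb K B).
Proof.
have ck (W : E) : cay (- Y) ** (cay Y ** W) = W.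
  by rewrite comp_lfunA cayVK// comp_lfun1l.
move=> [K2 Kg]; split=> [|u v].
  rewrite orbE -!comp_lfunA ck [K ** (K ** _)]comp_lfunA K2.
  by rewrite comp_lfunNl comp_lfunNr comp_lfun1l cayK.
rewrite orbE !comp_lfunE cay_adj// -[cay (- Y) (cay Y _)]comp_lfunE cayVK//.
rewrite id_lfunE Kg cay_adj// opprK -[cay Y (cay _ _)]comp_lfunE cayK//.
by rewrite id_lfunE.
Qed.

Lemma orb_comm X : X ** B = B ** X -> X ** K = K ** X ->
  X ** orb K B = orb K B ** X.
Proof.
move=> XB XK.
have XY : X ** Y = Y ** X by rewrite -comp_lfunZr -comp_lfunZl XB.
have XY' : X ** (- Y) = (- Y) ** X by rewrite comp_lfunNr comp_lfunNl XY.
rewrite orbE !comp_lfunA (cay_comm Yo XY) -[cay Y ** X ** K]comp_lfunA XK.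
by rewrite -!comp_lfunA (cay_comm Y'o XY').
Qed.

Lemma orb_kill (p : E) : B ** p = 0 -> p ** K = K ** p -> orb K B ** p = K ** p.
Proof.
move=> Bp pK; have Yp : Y ** p = 0 by rewrite -comp_lfunZl Bp scaler0.
have Y'p : (- Y) ** p = 0 by rewrite comp_lfunNl Yp oppr0.
by rewrite orbE -!comp_lfunA (cay_kill Y'o Y'p) -pK comp_lfunA cay_kill.
Qed.

(** Tangent vectors at a moved point are the conjugates of those at the base
    point, so the tangent spaces have constant dimension along an orbit. *)
Lemma comm_orb A : comm_lfun A (orb K B) =
  cay Y ** comm_lfun (cay (- Y) ** A ** cay Y) K ** cay (- Y).
Proof.
have ck (W : E) : cay Y ** (cay (- Y) ** W) = W.
  by rewrite comp_lfunA cayK// comp_lfun1l.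
rewrite /comm_lfun orbE comp_lfunDr comp_lfunDl comp_lfunNr comp_lfunNl.
by rewrite -!comp_lfunA !ck cayK// comp_lfun1r.
Qed.

Lemma skew_conj A : ortho_alg g A -> ortho_alg g (cay (- Y) ** A ** cay Y).
Proof.
by move=> Ao u v; rewrite !comp_lfunE cay_adj// opprK Ao cay_adj.
Qed.

Lemma conj_comm X A : X ** B = B ** X -> X ** A = A ** X ->
  X ** (cay (- Y) ** A ** cay Y) = (cay (- Y) ** A ** cay Y) ** X.
Proof.
move=> XB XA.
have XY : X ** Y = Y ** X by rewrite -comp_lfunZr -comp_lfunZl XB.
have XY' : X ** (- Y) = (- Y) ** X by rewrite comp_lfunNr comp_lfunNl XY.
rewrite !comp_lfunA (cay_comm Y'o XY') -[_ ** X ** A]comp_lfunA XA.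
by rewrite -!comp_lfunA (cay_comm Yo XY).
Qed.

Lemma conj_kill A (p : E) : B ** p = 0 -> A ** p = 0 ->
  (cay (- Y) ** A ** cay Y) ** p = 0.
Proof.
move=> Bp Ap; have Yp : Y ** p = 0 by rewrite -comp_lfunZl Bp scaler0.
by rewrite -comp_lfunA (cay_kill Yo Yp) -comp_lfunA Ap comp_lfun0r.
Qed.

End Orbit.

End Cayley.

(** * Partial inverses relative to a fixed kernel *)

Section PartialInverse.
Variables (R : realType) (V : vectType R).
Local Notation E := 'End(V).
Local Notation "A ** B" := (comp_lfun A B) (at level 40, left associativity).

Definition block (q s p : E) : E := (\1%VF - p) ** (q ** s) ** (\1%VF - p) + p.

(** An inverse of [q] on the range of [1 - p].  Writing it with the factor [s]
    makes its failure to invert [q] globally a multiple of [p s q] on one side and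
    of [q s p] on the other; these are the quantities to be shown to vanish. *)
Definition pinv (q s p : E) : E := s ** (\1%VF - p) ** ((block q s p)^-1)%VF.

Variables (q s p : E).
Hypothesis (qs : q ** s = s ** q) (pp : p ** p = p) (sp : s ** p = p ** s).
Let r := \1%VF - p.
Let a := block q s p.
Hypothesis ia : invertible a.
Let ai := (a^-1)%VF.
Let pi := pinv q s p.

Let rp : r ** p = 0.
Proof. by rewrite /r comp_lfunDl comp_lfunNl comp_lfun1l pp subrr. Qed.
Let pr : p ** r = 0.
Proof. by rewrite /r comp_lfunDr comp_lfunNr comp_lfun1r pp subrr. Qed.
Let rr : r ** r = r.
Proof. by rewrite {2}/r comp_lfunDr comp_lfunNr comp_lfun1r rp subr0. Qed.
Let sr : s ** r = r ** s.
Proof.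
by rewrite comp_lfunDl comp_lfunDr comp_lfunNl comp_lfunNr comp_lfun1l
  comp_lfun1r sp.
Qed.

Let aai : a ** ai = \1%VF. Proof. exact: comp_lfunV ia. Qed.
Let aia : ai ** a = \1%VF. Proof. exact: comp_Vlfun ia. Qed.

Lemma inv_comm X : X ** a = a ** X -> X ** ai = ai ** X.
Proof.
move=> Xa; rewrite -[LHS]comp_lfun1l -aia -comp_lfunA.
by rewrite [a ** _]comp_lfunA -Xa -!comp_lfunA aai comp_lfun1r.
Qed.

Let ap : a ** p = p.
Proof.
by rewrite /a /block -/r comp_lfunDl -comp_lfunA rp comp_lfun0r add0r pp.
Qed.
Let pa : p ** a = p.
Proof.
by rewrite /a /block -/r comp_lfunDr !comp_lfunA pr !comp_lfun0l add0r pp.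
Qed.
Let aip : ai ** p = p.
Proof. by rewrite -{1}ap comp_lfunA aia comp_lfun1l. Qed.
Let pai : p ** ai = p.
Proof. by rewrite -{1}pa -comp_lfunA aai comp_lfun1r. Qed.
Let rai : r ** ai = ai ** r.
Proof.
by rewrite comp_lfunDl comp_lfunDr comp_lfunNl comp_lfunNr comp_lfun1l
  comp_lfun1r aip pai.
Qed.
Let sai : s ** ai = ai ** s.
Proof.
apply: inv_comm; rewrite /a /block -/r comp_lfunDl comp_lfunDr sp; congr (_ + _).
have srW (W : E) : s ** (r ** W) = r ** (s ** W) by rewrite !comp_lfunA sr.
have sqW (W : E) : s ** (q ** W) = q ** (s ** W) by rewrite !comp_lfunA qs.
by rewrite -!comp_lfunA srW sqW -sr.
Qed.

Let rPr : r ** (q ** s) ** r = a - p.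
Proof. by rewrite /a /block addrK. Qed.

Lemma comp_pinv : q ** pi = r + p ** s ** q ** (r ** ai).
Proof.
have -> : q ** pi = (q ** s) ** r ** ai by rewrite /pi /pinv !comp_lfunA.
have -> : (q ** s) ** r = r ** (q ** s) ** r + p ** (q ** s) ** r.
  by rewrite -!comp_lfunDl subrK comp_lfun1l.
rewrite rPr (comp_lfunDl (a - p)) (comp_lfunDl a) comp_lfunNl aai pai; congr (_ + _).
by rewrite qs !comp_lfunA.
Qed.

Lemma pinv_comp : pi ** q = r + r ** ai ** (q ** s ** p).
Proof.
rewrite rai.
have -> : pi ** q = ai ** (r ** (q ** s)).
  have srai : s ** r ** ai = ai ** r ** s.
    by rewrite -(comp_lfunA s) rai (comp_lfunA s) sai -[LHS]comp_lfunA sr comp_lfunA.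
  by rewrite /pi /pinv -/r -/a -/ai srai -!comp_lfunA qs.
have -> : r ** (q ** s) = r ** (q ** s) ** r + r ** (q ** s) ** p.
  by rewrite -comp_lfunDr subrK comp_lfun1r.
rewrite rPr (comp_lfunDr _ (a - p)) (comp_lfunDr _ a) comp_lfunNr aia aip; congr (_ + _).
by rewrite !comp_lfunA.
Qed.

Lemma pinvp : pi ** p = 0.
Proof.
rewrite /pi /pinv -/r -/a -/ai -(comp_lfunA (s ** r)) aip -comp_lfunA rp.
by rewrite comp_lfun0r.
Qed.

Lemma ppinv : p ** pi = 0.
Proof. by rewrite /pi /pinv -/r sr !comp_lfunA pr !comp_lfun0l. Qed.

Let rpi : r ** pi = pi.
Proof. by rewrite comp_lfunDl comp_lfunNl ppinv subr0 comp_lfun1l. Qed.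
Let pir : pi ** r = pi.
Proof. by rewrite comp_lfunDr comp_lfunNr pinvp subr0 comp_lfun1r. Qed.
Let piqr : pi ** q ** r = r.
Proof. by rewrite pinv_comp comp_lfunDl rr -!comp_lfunA pr !comp_lfun0r addr0. Qed.
Let rqpi : r ** (q ** pi) = r.
Proof. by rewrite comp_pinv comp_lfunDr rr !comp_lfunA rp !comp_lfun0l addr0. Qed.

(** The partial inverse inherits the symmetries of [q] and [p] although [s] need
    not have them: it is the inverse of the compression of [q] to the range of
    [1 - p]. *)
Lemma pinv_comm X : X ** q = q ** X -> X ** p = p ** X -> X ** pi = pi ** X.
Proof.
move=> Xq Xp.
have Xr : X ** r = r ** X.
  by rewrite comp_lfunDl comp_lfunDr comp_lfunNl comp_lfunNr comp_lfun1l
    comp_lfun1r Xp.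
have e1 : X ** pi = r ** (X ** pi) by rewrite comp_lfunA -Xr -comp_lfunA rpi.
have e2 (W : E) : q ** (X ** W) = X ** (q ** W) by rewrite !comp_lfunA Xq.
have e3 (W : E) : r ** (X ** W) = X ** (r ** W) by rewrite !comp_lfunA Xr.
transitivity (pi ** (X ** (q ** pi))).
  have e4 (W : E) : r ** W = pi ** (q ** (r ** W)) by rewrite !comp_lfunA piqr.
  by rewrite {1}e1 e4 -e1 e2.
have e5 (W : E) : pi ** W = pi ** (r ** W) by rewrite comp_lfunA pir.
by rewrite e5 e3 rqpi Xr -e5.
Qed.

Lemma pinv_sym (g : {dot V for idfun}) :
  (forall u v, g (q u) v = g u (q v)) -> (forall u v, g (p u) v = g u (p v)) ->
  forall u v, g (pi u) v = g u (pi v).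
Proof.
move=> gq gp.
have gr u v : g (r u) v = g u (r v) by rewrite !lfE !gE gp.
have rpiv u : r (pi u) = pi u by rewrite -comp_lfunE rpi.
have rq u : r (q (pi u)) = r u by rewrite -[q (pi u)]comp_lfunE -comp_lfunE rqpi.
move=> u v; rewrite -rpiv gr -rq -gr rpiv -gq -[pi v]rpiv -gr rq gr.
by rewrite rpiv.
Qed.

Lemma pinv_ker v : s v = 0 -> pi v = 0.
Proof.
move=> sv; rewrite /pi /pinv -/r -/a -/ai -comp_lfunA rai comp_lfunA sai.
by rewrite -comp_lfunA sr !comp_lfunE sv !linear0.
Qed.

Lemma block_ker v : q ** s ** p = 0 -> q (s v) = 0 -> p v = v.
Proof.
move=> f0 Pv; have rv : r v = 0.
  have : a (r v) = 0.
    rewrite -comp_lfunE /a /block -/r comp_lfunDl -!comp_lfunA pr rr addr0.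
    rewrite comp_lfunE [q ** _]comp_lfunA /r comp_lfunDr comp_lfunNr f0 oppr0.
    by rewrite addr0 comp_lfun1r [(q ** s) v]comp_lfunE Pv linear0.
  move=> arv; rewrite -[r v]id_lfunE -aia comp_lfunE arv linear0.
  by [].
by move: rv; rewrite /r !lfE => /eqP; rewrite subr_eq0 eq_sym => /eqP.
Qed.

End PartialInverse.

(** * Subspaces and small growth *)

Lemma linear_set_vspace (F : fieldType) (V : vectType F) (D : set V) :
  D 0 -> (forall a u v, D u -> D v -> D (a *: u + v)) ->
  exists W : {vspace V}, forall x, x \in W <-> D x.
Proof.
move=> D0 DL.
pose sub n := `[< exists2 W : {vspace V}, (forall x, x \in W -> D x) & \dim W = n >].
have sub0 : exists n, sub n.
  exists 0%N; apply/asboolP; exists 0%VS; last exact: dimv0.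
  by move=> x; rewrite memv0 => /eqP ->.
have subB n : sub n -> (n <= \dim {:V})%N.
  by move=> /asboolP[W _ <-]; exact/dimvS/subvf.
case: (ex_maxnP sub0 subB) => n /asboolP[W WD Wn] nmax.
exists W => x; split=> [|Dx]; first exact: WD.
have [//|xW] := boolP (x \in W).
have : sub (\dim (W + <[x]>)%VS).
  apply/asboolP; exists (W + <[x]>)%VS => // y /memv_addP[w wW [z /vlineP[a ->] ->]].
  by rewrite addrC; apply: DL => //; exact: WD.
move=> /nmax; rewrite dimv_disjoint_sum.
  rewrite dim_vline Wn -[X in (_ <= X)%N -> _]addn0 leq_add2l.
  by case: eqP xW => [->|//]; rewrite mem0v.
apply/eqP; rewrite -subv0; apply/subvP => y.
rewrite memv_cap => /andP[yW /vlineP[a yE]].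
rewrite memv0; have [a0|a0] := eqVneq a 0; first by rewrite yE a0 scale0r.
case/negP: xW; have -> : x = a^-1 *: y by rewrite yE scalerA mulVf// scale1r.
exact: memvZ.
Qed.

Lemma linear_linfunE (F : fieldType) (U V : vectType F) (f : U -> V) x :
  linear f -> linfun f x = f x.
Proof.
move=> fL.
pose l : {linear U -> V} := HB.pack f (GRing.isLinear.Build F _ _ _ _ fL).
by rewrite -[f]/(l : U -> V) lfunE.
Qed.

(** A Gronwall argument without integration: when the growth rate is small, the
    mean value inequality up to the point where the sum of the two norms is
    maximal bounds this maximum by a proper fraction of itself. *)
Lemma small_growth_zero (R : realType) (U V : vectType R)
    (f1 f2 df1 df2 : R -> 'Hom(U, V)) (k : R) : 2 * k < 1 ->
  (forall t : R, 0 <= t <= 1 ->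
    [/\ is_diff t f1 (fun s => s *: df1 t), is_diff t f2 (fun s => s *: df2 t),
        `|df1 t| <= k * (`|f1 t| + `|f2 t|) &
        `|df2 t| <= k * (`|f1 t| + `|f2 t|)]) ->
  f1 0 = 0 -> f2 0 = 0 -> f1 1 = 0.
Proof.
move=> k1 fP f10 f20.
pose n t := `|f1 t| + `|f2 t|.
have nC : {within `[0, 1], continuous n}.
  apply: continuous_in_subspaceT => t; rewrite inE /= in_itv => /= t01.
  have [[d1 _] [d2 _] _ _] := fP t t01.
  have c1 := differentiable_continuous d1; have c2 := differentiable_continuous d2.
  by apply: cvgD; exact: cvg_norm.
have [c] := EVT_max ler01 nC; rewrite in_itv /= => /andP[c0 c1] cmax.
have k0 : 0 <= k * n c.
  have [_ _ le1 _] := fP c (introT andP (conj c0 c1)).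
  exact: le_trans le1.
have bnd (f df : R -> 'Hom(U, V)) : (forall t : R, 0 <= t <= 1 ->
    is_diff t f (fun s => s *: df t) /\ `|df t| <= k * n t) ->
    f 0 = 0 -> `|f c| <= k * n c.
  move=> ffP f0; have := @mean_value _ _ _ f df c (k * n c) c0.
  rewrite f0 subr0 => h; apply: le_trans (h _) _; last by rewrite ler_piMr.
  move=> t /andP[t0 tc]; have t01 : 0 <= t <= 1 by rewrite t0 (le_trans tc).
  have [dt dtn] := ffP t t01; split=> //; apply: le_trans dtn _.
  have nt : n t <= n c by apply: cmax; rewrite in_itv /= t01.
  have [k_ge0|k_lt0] := leP 0 k; first by rewrite ler_wpM2l.
  have nc0 : n c <= 0 by rewrite -(ler_nM2l k_lt0) mulr0.
  have nt0 : 0 <= n t by rewrite addr_ge0.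
  by have -> : n t = n c by lra.
have b1 : `|f1 c| <= k * n c by apply: (bnd _ df1) => // t /fP[].
have b2 : `|f2 c| <= k * n c by apply: (bnd _ df2) => // t /fP[].
have nc0 : n c <= 0.
  have : n c <= 2 * k * n c by rewrite -mulrA mulr2n mulrDl mul1r lerD.
  have : 0 <= n c by rewrite addr_ge0.
  nra.
have : n 1 <= n c by apply: cmax; rewrite in_itv /= lexx ler01.
rewrite {1}/n => n1; apply/eqP; rewrite -normr_le0.
have := normr_ge0 (f2 1); lra.
Qed.

(** * The sections [S] *)

Section Sections.
Variables (R : realType) (V : vectType R) (g : {dot V for idfun}) (J : 'End(V)).
Local Notation E := 'End(V).
Local Notation "A ** B" := (comp_lfun A B) (at level 40, left associativity).
Hypothesis Jt : twistor g J.

(** What the argument uses of [S]: each of the four choices is a polynomial in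
    [J] and [K].  Its kernel is stable under both since [J + K] and [J - K]
    intertwine [J] and [K] up to sign, and [[J, K]] anticommutes with both. *)
Record equivariant (S : E -> E) (s : R) : Prop := Equivariant {
  eqv_smooth : smooth_on setT S;
  eqv_adj : forall K, twistor g K -> forall u v, g (S K u) v = s * g u (S K v);
  eqv_comm : forall K X, X ** J = J ** X -> X ** K = K ** X ->
    X ** S K = S K ** X;
  eqv_ker : forall K, twistor g K -> forall v, S K v = 0 ->
    S K (J v) = 0 /\ S K (K v) = 0;
  eqv_local : forall K L p, K ** p = L ** p -> p ** J = J ** p ->
    p ** K = K ** p -> p ** L = L ** p -> S K ** p = S L ** p
}.

Lemma S_sections_equivariant S : S_sections J S -> exists s, equivariant S s.
Proof.
have sm_id : smooth_on setT (idfun : E -> E).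
  by apply: smooth_linear => //; [exact: openT|move=> x].
have sm_cst (c : E) : smooth_on setT (fun _ : E => c) by apply: smooth_cst; exact: openT.
have [_ Jo] := (twistorE g J).1 Jt.
have JJ v := twistorK v Jt.
case=> ->.
- exists 1; split.
  + exact: sm_cst.
  + by move=> K _ u v; rewrite !id_lfunE mul1r.
  + by move=> K X _ _; rewrite comp_lfun1l comp_lfun1r.
  + by move=> K _ v; rewrite id_lfunE => ->; rewrite !linear0.
  + by [].
- exists (-1); split.
  + exact (smooth_add openT (sm_cst J) sm_id).
  + move=> K /twistorE[_ Ko] u v; rewrite !lfE !gE Jo Ko; ring.
  + by move=> K X XJ XK; rewrite comp_lfunDr comp_lfunDl XJ XK.
  + move=> K Kt v; have KK w := twistorK w Kt.
    rewrite !lfE => /eqP; rewrite addr_eq0 => /eqP Jv.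
    have Kv : K v = - J v by rewrite Jv opprK.
    have KJv : K (J v) = v by rewrite Jv lfunN KK opprK.
    have JKv : J (K v) = v by rewrite Kv lfunN JJ opprK.
    by rewrite JJ KK KJv JKv addrN addNr.
  + by move=> K L p KL _ _ _; rewrite !comp_lfunDl KL.
- exists (-1); split.
  + refine (smooth_add openT (sm_cst J) _).
    apply: smooth_linear; [exact: openT|by move=> a u v; rewrite opprD scalerN|].
    by move=> x; exact: opp_continuous.
  + move=> K /twistorE[_ Ko] u v; rewrite !lfE !gE Jo Ko; ring.
  + move=> K X XJ XK; rewrite comp_lfunDr comp_lfunDl comp_lfunNl comp_lfunNr.
    by rewrite XJ XK.
  + move=> K Kt v; have KK w := twistorK w Kt.
    rewrite !lfE => /eqP; rewrite subr_eq0 => /eqP Jv.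
    have KJv : K (J v) = - v by rewrite Jv KK.
    have JKv : J (K v) = - v by rewrite -Jv JJ.
    by rewrite JJ KK KJv JKv addrN.
  + by move=> K L p KL _ _ _; rewrite !comp_lfunDl !comp_lfunNl KL.
- exists (-1); split.
  + refine (smooth_add openT _ _).
      exact (smooth_comp_lfun openT (sm_cst J) sm_id).
    apply: (@smooth_linear_comp _ _ _ _ _ (fun X : E => - X)) => //.
    * exact: openT.
    * by move=> a u v; rewrite opprD scalerN.
    * by move=> x; exact: opp_continuous.
    * exact (smooth_comp_lfun openT sm_id (sm_cst J)).
  + move=> K /twistorE[_ Ko] u v; rewrite !lfE !gE.
    rewrite (Jo (K u)) (Ko u) (Ko (J u)) (Jo u); ring.
  + move=> K X XJ XK; rewrite /comm_lfun comp_lfunDr comp_lfunDl comp_lfunNl comp_lfunNr.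
    by rewrite !comp_lfunA XJ XK -!comp_lfunA XJ XK.
  + move=> K Kt v; have KK w := twistorK w Kt.
    rewrite !lfE => /eqP; rewrite subr_eq0 => /eqP Jv.
    have JKJ : J (K (J v)) = - K v by rewrite -Jv JJ.
    have KJK : K (J (K v)) = - J v by rewrite Jv KK.
    by rewrite JKJ KJK JJ KK !lfunN !opprK !addNr.
  + move=> K L p KL pJ pK pL; rewrite /comm_lfun !comp_lfunDl !comp_lfunNl.
    rewrite -!comp_lfunA KL -!pJ [K ** _]comp_lfunA [L ** (p ** _)]comp_lfunA KL.
    by [].
Qed.

End Sections.

(** * The distributions along an orbit *)

Section Distributions.
Variables (R : realType) (V : vectType R) (g : {dot V for idfun}).
Local Notation E := 'End(V).
Local Notation "A ** B" := (comp_lfun A B) (at level 40, left associativity).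
Implicit Types (A B C K X P : E) (G : set E).

(** With [G] empty this is the first distribution, with [G] reduced to [J] the
    second. *)
Definition orbit_distr G P K : set E :=
  [set C | exists B, [/\ skew_centralizer g G B, forall v, P v = 0 -> B v = 0 &
                         C = comm_lfun B K]].

Lemma comm0_lfun A B : comm_lfun A B = 0 <-> A ** B = B ** A.
Proof. by split=> [/subr0_eq//|]; rewrite /comm_lfun => ->; rewrite subrr. Qed.

Lemma distrE (P : E -> E) s K : twistor g K ->
  (forall u v, g (P K u) v = s * g u (P K v)) ->
  (forall v, P K v = 0 -> P K (K v) = 0) ->
  distr g P K = orbit_distr set0 (P K) K.
Proof.
move=> Kt Ps PK; apply/seteqP; split=> C.
  move=> [Ca CP]; have [Bo CE] := ortho_anti_comm Kt Ca.
  have Co := Ca.1; have kC := (ker_im_compatE Ps Co).1 CP.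
  exists (- 2^-1 *: (C ** K)); split=> // v Pv.
  by rewrite !lfE kC ?scaler0//; exact: PK.
move=> [B [[Bo _] kB ->]]; have Ca := comm_ortho_anti Kt Bo.
split=> //; apply/(ker_im_compatE Ps Ca.1) => v Pv.
by rewrite comm_lfunE (kB _ (PK _ Pv)) (kB _ Pv) linear0 subrr.
Qed.

Lemma distr_uE (J : E) (P : E -> E) s K : twistor g K ->
  (forall u v, g (P K u) v = s * g u (P K v)) ->
  distr_u g J P K = orbit_distr [set J] (P K) K.
Proof.
move=> Kt Ps; apply/seteqP; split=> C.
  move=> [_ [B [[Bo BJ] BP ->]]]; exists B; split=> //.
  - by split=> // X ->; exact/comm0_lfun.
  - exact/(ker_im_compatE Ps Bo).
move=> [B [[Bo BJ] kB ->]]; split; first exact: comm_ortho_anti.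
exists B; split=> //; last exact/(ker_im_compatE Ps Bo).
by split=> //; apply/comm0_lfun; exact: BJ.
Qed.

(** Two extensions agree along a curve of conjugates of [K], which stays in the
    twistor space, and so have the same derivative along its velocity: the choice
    of an extension in [dsection] is immaterial. *)
Lemma dsectionE (Q : E -> E) K F A : twistor g K -> smooth_extension g Q K F ->
  ortho_alg g A -> dsection g Q K (comm_lfun A K) = 'D_(comm_lfun A K) F K.
Proof.
move=> Kt [U [oU UK FU FQ]] Ao; rewrite /dsection.
have ext : smooth_extension g Q K F by exists U.
have [U' [oU' U'K F'U' F'Q]] : smooth_extension g Q K
    (xget Q [set F | smooth_extension g Q K F]) by apply: xgetPex; exists F.
set F' := xget _ _ in F'U' F'Q *.
have o0 : ortho_alg g 0 by move=> u v; rewrite !lfE !gE oppr0.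
pose c (t : R) := orb K (t *: A + 0).
have c0 : c 0 = K by rewrite /c scale0r add0r orb0.
have dc : is_diff 0 c (fun t => t *: comm_lfun A K).
  have := @is_diff_line _ _ _ (orb K) (fun Z => comm_lfun (gen 0 Z) K) 0 A 0.
  rewrite scale0r addr0 (gen0 g) => h; apply: h.
  by have := is_diff_orb K o0; rewrite orb0.
have chain (H : E -> E) (W : set E) : smooth_on W H -> open W -> W K ->
    is_diff 0 (H \o c) (fun t => 'D_(t *: comm_lfun A K) H K).
  move=> HW oW WK; apply: is_diff_comp dc _; rewrite c0.
  exact: smooth_is_diff HW WK.
have d1 := chain F U FU oU UK; have d2 := chain F' U' F'U' oU' U'K.
have nc (W : set E) : open W -> W K -> \forall t \near (0 : R), W (c t).
  move=> oW WK; have [/differentiable_continuous cc _] := dc.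
  by apply: cc; rewrite c0; exact: open_nbhs_nbhs.
have FF' : \forall t \near (0 : R), (F \o c) t = (F' \o c) t.
  apply: filterS2 (nc _ oU UK) (nc _ oU' U'K) => t Ut U't /=.
  have ct : twistor g (c t).
    by apply: (orb_twistor _ Kt); rewrite addr0; exact: skew_scale.
  by rewrite FQ// F'Q.
have [_ e1] := near_is_diff FF' d1; have [_ e2] := d2.
have := congr1 (fun f => f 1) (etrans (esym e1) e2).
by rewrite scale1r.
Qed.

End Distributions.

(** * Leaves *)

Section Leaf.
Variables (R : realType) (V : vectType R) (g : {dot V for idfun}).
Variables (J : 'End(V)) (Q S : 'End(V) -> 'End(V)) (s : R) (G : set 'End(V)).
Local Notation E := 'End(V).
Local Notation "A ** B" := (comp_lfun A B) (at level 40, left associativity).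
Hypothesis Jt : twistor g J.
Hypothesis Q_smooth : smooth_section g Q.
Hypothesis Q_adj : forall K, twistor g K -> self_adjoint g (Q K).
Hypothesis Q_J : forall K, twistor g K -> comm_lfun (Q K) J = 0.
Hypothesis Q_phi : forall K, twistor g K -> comm_lfun (Q K) K = 0.
Hypothesis eqS : equivariant g J S s.
Hypothesis GJ : G `<=` [set J].
Hypothesis dQ : forall K, twistor g K -> forall A, skew_centralizer g G A ->
  (forall v, S K v = 0 -> A v = 0) ->
  dsection g Q K (Q K ** comm_lfun A K ** Q K) =
  Q K ** dsection g Q K (comm_lfun A K) ** Q K.
Local Notation P K := (Q K ** S K).

Let QJ (K : E) : twistor g K -> Q K ** J = J ** Q K.
Proof. by move=> /Q_J/comm0_lfun. Qed.
Let QK (K : E) : twistor g K -> Q K ** K = K ** Q K.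
Proof. by move=> /Q_phi/comm0_lfun. Qed.
Let QS (K : E) : twistor g K -> Q K ** S K = S K ** Q K.
Proof. by move=> Kt; apply: (eqv_comm eqS); [exact: QJ|exact: QK]. Qed.

Lemma P_adj (K : E) : twistor g K -> forall u v, g (P K u) v = s * g u (P K v).
Proof.
move=> Kt u v; rewrite QS// [in LHS]comp_lfunE (eqv_adj eqS)// Q_adj//.
by rewrite -QS// comp_lfunE.
Qed.

Lemma P_ker (K : E) : twistor g K -> forall v, P K v = 0 ->
  P K (J v) = 0 /\ P K (K v) = 0.
Proof.
move=> Kt v; rewrite QS// !comp_lfunE => SQ.
have [SJ SK] := eqv_ker eqS Kt SQ.
have QJv : Q K (J v) = J (Q K v) by rewrite -!comp_lfunE QJ.
have QKv : Q K (K v) = K (Q K v) by rewrite -!comp_lfunE QK.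
by rewrite QJv QKv.
Qed.

Section AtBasePoint.
Variables (K0 : E) (F : E -> E) (UF : set E).
Hypothesis K0t : twistor g K0.
Hypothesis oUF : open UF.
Hypothesis UFK0 : UF K0.
Hypothesis FU : smooth_on UF F.
Hypothesis FQ : forall L, UF L -> twistor g L -> F L = Q L.

Let p : E := ker_proj (P K0).
Let p_sym u v : g (p u) v = g u (p v).
Proof. exact: ker_proj_sym (P_adj K0t) u v. Qed.
Let pp : p ** p = p.
Proof. exact: ker_projK (P_adj K0t). Qed.
Let pJ : p ** J = J ** p.
Proof.
have [_ Jo] := (twistorE g J).1 Jt.
rewrite (skew_ker_stable_comm (P_adj K0t) Jo)// => v /(P_ker K0t)[] //.
Qed.
Let pK0 : p ** K0 = K0 ** p.
Proof.
have [_ Ko] := (twistorE g K0).1 K0t.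
rewrite (skew_ker_stable_comm (P_adj K0t) Ko)// => v /(P_ker K0t)[] //.
Qed.
Let sigma : E := S K0 ** p.

(** The infinitesimal symmetries that fix the kernel of [P K0] pointwise. *)
Let stab (B : E) : Prop := skew_centralizer g G B /\ B ** p = 0.

(** The orbit of [K0] stays among these points; there [S] has the same values on
    the kernel of [P K0] as at [K0]. *)
Let admissible (K : E) : Prop :=
  [/\ twistor g K, p ** K = K ** p & K ** p = K0 ** p].

Let stab_p B : stab B -> p ** B = 0.
Proof. by move=> [[Bo _] Bp]; exact: skew_killC p_sym Bp. Qed.

Let admissible_orb (K B : E) : admissible K -> stab B -> admissible (orb K B).
Proof.
move=> [Kt pK KK0] sB; have pB := stab_p sB; have [[Bo _] Bp] := sB.
split; first exact: orb_twistor.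
  by apply: (orb_comm Bo) => //; rewrite pB Bp.
by rewrite (orb_kill Bo Bp pK) KK0.
Qed.

Let admissible0 : admissible K0. Proof. by []. Qed.

Let S_p (K : E) : admissible K -> S K ** p = sigma.
Proof. by move=> [Kt pK KK0]; exact: (eqv_local eqS). Qed.

Let S_comm_p (K : E) : admissible K -> S K ** p = p ** S K.
Proof. by move=> [Kt pK KK0]; rewrite (eqv_comm eqS). Qed.

Let dF_comm (K B : E) : admissible K -> UF K -> ortho_alg g B ->
  dsection g Q K (comm_lfun B K) = dop F K (comm_lfun B K).
Proof.
move=> [Kt _ _] UK Bo; rewrite (dsectionE (F := F))//; last first.
  by exists UF; split.
by rewrite (dopE _ (smooth_is_diff FU UK)).
Qed.

(** The difference between [Q X C X Q] and [C], for [C = comm_lfun B K] with [B]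
    in the stabilizer: every term has [f1] or [f2] as a factor. *)
Let error (b C f1 f2 : E) : E :=
  f2 ** b ** C + C ** (b ** f1) + f2 ** b ** C ** (b ** f1).

(** The hypothesis on [dQ] applies to [X C X], which is the commutator of [X B X]
    with [K]. *)
Let dF_stab (K B : E) (q := F K) (X := pinv q (S K) p)
    (C := comm_lfun B K) (b := (\1%VF - p) ** ((block q (S K) p)^-1)%VF)
    (f1 := q ** sigma) (f2 := sigma ** q) :
  admissible K -> UF K -> invertible (block q (S K) p) -> stab B ->
  dop F K C ** sigma =
    q ** dop F K (X ** C ** X) ** f1 - dop F K (error b C f1 f2) ** sigma /\
  sigma ** dop F K C =
    f2 ** dop F K (X ** C ** X) ** q - sigma ** dop F K (error b C f1 f2).
Proof.
move=> aK UK iK sB; have [Kt pK KK0] := aK; have [[Bo BG] Bp] := sB.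
have pB := stab_p sB.
have qQ : q = Q K by rewrite /q FQ.
have qs : q ** S K = S K ** q by rewrite qQ QS.
have sp := S_comm_p aK.
have f1E : f1 = q ** S K ** p by rewrite -comp_lfunA S_p.
have f2E : f2 = p ** S K ** q by rewrite -sp S_p.
have Xcomm Y : Y ** q = q ** Y -> Y ** p = p ** Y -> Y ** X = X ** Y.
  exact: pinv_comm qs pp sp iK Y.
have XK : K ** X = X ** K by apply: Xcomm; rewrite // qQ QK.
have XJ : J ** X = X ** J by apply: Xcomm; rewrite // qQ QJ.
have Xs : forall u v, g (X u) v = g u (X v).
  by apply: (pinv_sym qs pp sp iK) => // u v; rewrite qQ Q_adj.
have Xk v : S K v = 0 -> X v = 0 by exact: (pinv_ker qs pp sp iK).
have qX : q ** X = \1%VF - p + f2 ** b.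
  by rewrite /X (comp_pinv qs pp iK) -f2E.
have Xq : X ** q = \1%VF - p + b ** f1.
  by rewrite /X (pinv_comp qs pp sp iK) -f1E.
clearbody X b; clear Xcomm.
pose A := X ** B ** X.
have Ac : skew_centralizer g G A.
  split=> [u v|Y GY]; first by rewrite /A !comp_lfunE Xs Bo Xs.
  have := GJ GY => /= YJ; rewrite YJ in GY *.
  rewrite /A -comp_lfunA -XJ !comp_lfunA -[_ ** B ** J]comp_lfunA (BG _ GY).
  by rewrite !comp_lfunA XJ.
have AC : comm_lfun A K = X ** C ** X.
  rewrite /A /C /comm_lfun !comp_lfunDr !comp_lfunDl !comp_lfunNr !comp_lfunNl.
  by rewrite -!comp_lfunA -XK !comp_lfunA XK.
have Ak v : S K v = 0 -> A v = 0.
  by move=> /Xk Xv; rewrite /A comp_lfunE Xv linear0.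
have Ao := Ac.1; clearbody A.
have qK : q ** K = K ** q by rewrite qQ QK.
pose A' := q ** A ** q.
have A'o : ortho_alg g A'.
  by move=> u v; rewrite /A' qQ !comp_lfunE Q_adj// Ao Q_adj.
have A'C : comm_lfun A' K = q ** (X ** C ** X) ** q.
  rewrite -AC /A' /comm_lfun !comp_lfunDr !comp_lfunDl !comp_lfunNr !comp_lfunNl.
  by rewrite -!comp_lfunA -qK !comp_lfunA qK.
have key : dop F K (q ** (X ** C ** X) ** q) = q ** dop F K (X ** C ** X) ** q.
  have := dQ Kt Ac Ak.
  have -> : Q K ** comm_lfun A K ** Q K = comm_lfun A' K by rewrite A'C AC qQ.
  by rewrite !dF_comm// A'C AC qQ.
have Cp : C ** p = 0.
  rewrite /C /comm_lfun comp_lfunDl comp_lfunNl -!comp_lfunA -pK comp_lfunA Bp.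
  by rewrite !comp_lfun0l comp_lfun0r subrr.
have pC : p ** C = 0.
  rewrite /C /comm_lfun comp_lfunDr comp_lfunNr !comp_lfunA pK pB -!comp_lfunA pB.
  by rewrite comp_lfun0l comp_lfun0r subrr.
have rC : (\1%VF - p) ** C = C by rewrite comp_lfunDl comp_lfunNl pC subr0 comp_lfun1l.
have Cr : C ** (\1%VF - p) = C by rewrite comp_lfunDr comp_lfunNr Cp subr0 comp_lfun1r.
have CE : C = q ** (X ** C ** X) ** q - error b C f1 f2.
  have -> : q ** (X ** C ** X) ** q = (q ** X) ** C ** (X ** q).
    by rewrite !comp_lfunA.
  rewrite qX Xq.
  rewrite comp_lfunDl rC comp_lfunDr comp_lfunDl Cr comp_lfunDl.
  rewrite -[f2 ** b ** C ** _]comp_lfunA Cr /error.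
  apply: (@g_ext _ _ g) => u v.
  by rewrite !add_lfunE !opp_lfunE !add_lfunE !gE; ring.
have DC : dop F K C = q ** dop F K (X ** C ** X) ** q -
    dop F K (error b C f1 f2) by rewrite {1}CE linearB /= key.
rewrite DC comp_lfunDl comp_lfunDr comp_lfunNl comp_lfunNr.
split; congr (_ - _); first by rewrite /f1 -!comp_lfunA.
by rewrite /f2 -!comp_lfunA.
Qed.


Local Notation d := ((\dim {:V})%:R : R).

Let comp_le (A B : E) x y : `|A| <= x -> `|B| <= y -> `|A ** B| <= d * x * y.
Proof.
move=> Ax By; apply: le_trans (comp_lfun_norm A B) _.
by apply: ler_pM; rewrite ?mulr_ge0// ler_wpM2l.
Qed.

(** Hence the derivatives of [f1] and [f2] along the orbit are bounded by [f1] and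
    [f2] themselves. *)
Lemma growth_bound (m : R) : 0 <= m -> exists2 k, 0 <= k &
  forall K B c, let q := F K in let X := pinv q (S K) p in
  let b := (\1%VF - p) ** ((block q (S K) p)^-1)%VF in
  let C := comm_lfun B K in let f1 := q ** sigma in let f2 := sigma ** q in
  admissible K -> UF K -> invertible (block q (S K) p) -> stab B ->
  `|q| <= m -> `|X| <= m -> `|b| <= m -> `|dop F K| <= m -> `|sigma| <= m ->
  `|C| <= c ->
  `|dop F K C ** sigma| <= k * c * (`|f1| + `|f2|) /\
  `|sigma ** dop F K C| <= k * c * (`|f1| + `|f2|).
Proof.
move=> m0; have [e e0 ev] := eval_bounded V V V V.
pose k1 := d * (d * m * (e * m * (d * (d * m) * m))).
pose k2 := d * d + d * d + d * (d * d) * (d * m * (d * m * m)).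
pose k := k1 + d * (e * m * (k2 * m)) * m.
exists k => [|K B c q X b C f1 f2 aK UK iK sB qm Xm bm Fm sm Cc].
  by rewrite /k /k1 /k2; repeat (apply: addr_ge0 || apply: mulr_ge0).
have c0 : 0 <= c by apply: le_trans Cc.
have [-> ->] := dF_stab aK UK iK sB; rewrite -/q -/X -/b -/C -/f1 -/f2.
set n := `|f1| + `|f2|.
have n0 : 0 <= n by rewrite addr_ge0.
have f1n : `|f1| <= n by rewrite lerDl.
have f2n : `|f2| <= n by rewrite lerDr.
have f1m : `|f1| <= d * m * m by exact: comp_le.
have dFle Y y : `|Y| <= y -> `|dop F K Y| <= e * m * y.
  move=> Yy; apply: le_trans (ev _ _) _.
  by apply: ler_pM; rewrite ?mulr_ge0// ler_wpM2l.
have dA : `|dop F K (X ** C ** X)| <= e * m * (d * (d * m * c) * m).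
  by apply: dFle; apply: comp_le => //; exact: comp_le.
have dE : `|dop F K (error b C f1 f2)| <= e * m * (k2 * m * c * n).
  apply: dFle; rewrite /error.
  have t1 : `|f2 ** b ** C| <= d * (d * n * m) * c by do 2 apply: comp_le => //.
  have t2 : `|C ** (b ** f1)| <= d * c * (d * m * n) by do 2 apply: comp_le => //.
  have t3 : `|f2 ** b ** C ** (b ** f1)| <=
    d * (d * (d * n * m) * c) * (d * m * (d * m * m)) by do 2 apply: comp_le => //.
  apply: le_trans (ler_normD _ _) _.
  rewrite [leRHS](_ : _ = d * (d * n * m) * c + d * c * (d * m * n) +
    d * (d * (d * n * m) * c) * (d * m * (d * m * m))); last by rewrite /k2; ring.
  by apply: lerD => //; apply: le_trans (ler_normD _ _) _; exact: lerD.
rewrite [k * c * n](_ : _ = d * (d * m * (e * m * (d * (d * m * c) * m))) * n +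
  d * (e * m * (k2 * m * c * n)) * m); last first.
  by rewrite /k /k1; ring.
split; apply: le_trans (ler_normB _ _) _; apply: lerD.
- by apply: comp_le => //; exact: comp_le.
- exact: comp_le.
- rewrite [leRHS](_ : _ = d * (d * n * (e * m * (d * (d * m * c) * m))) * m);
    last by ring.
  by apply: comp_le => //; exact: comp_le.
- rewrite [leRHS](_ : _ = d * m * (e * m * (k2 * m * c * n))); last by ring.
  exact: comp_le.
Qed.


Let block0 : invertible (block (F K0) (S K0) p).
Proof.
have pP : p ** P K0 = 0 by exact: ker_proj_comp (P_adj K0t).
have Pp : P K0 ** p = 0 by exact: comp_ker_proj.
rewrite FQ//; have -> : block (Q K0) (S K0) p = P K0 + p.
  rewrite /block comp_lfunDl comp_lfunNl pP subr0 comp_lfun1l.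
  by rewrite comp_lfunDr comp_lfunNr Pp subr0 comp_lfun1r.
apply: invertibleP => X X0.
have pX : p ** X = 0.
  have := congr1 (comp_lfun p) X0.
  by rewrite comp_lfun0r comp_lfunA comp_lfunDr pP add0r pp.
move: X0; rewrite comp_lfunDl pX addr0 => PX.
rewrite -pX; apply/lfunP => v; rewrite comp_lfunE.
by rewrite (ker_proj_id (P_adj K0t))// -comp_lfunE PX zero_lfunE.
Qed.

Let stab_lin a A B : stab A -> stab B -> stab (a *: A + B).
Proof.
move=> [sA Ap] [sB Bp]; split; first exact: skew_centralizer_lin.
by rewrite comp_lfunDl -comp_lfunZl Ap Bp scaler0 addr0.
Qed.

Let stab0 : stab 0.
Proof.
split; last exact: comp_lfun0l.
split=> [u v|X _]; first by rewrite !lfE !gE oppr0.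
by rewrite comp_lfun0l comp_lfun0r.
Qed.

Section Parametrization.
Variable l : 'End(E).
Hypothesis l_stab : forall x, stab (l x).

(** The orbit of [K0] under the stabilizer, parametrized through a linear map
    into the latter. *)
Let T (x : E) : E := orb K0 (l x).

Let T_admissible x : admissible (T x).
Proof. exact: admissible_orb. Qed.

Let T_diff x : is_diff x T (fun v => comm_lfun (gen (l x) (l v)) (T x)).
Proof.
have ld : is_diff x (fun y => l y + 0) l.
  apply: is_diff_affine; first exact: linearP.
  by apply: hom_linear_continuous; exact: linearP.
have lo : ortho_alg g (l x + 0) by rewrite addr0; case: (l_stab x) => -[].
have := is_diff_comp ld (is_diff_orb K0 lo); rewrite !addr0.
have -> // : orb K0 \o (fun y => l y + 0) = T.
by apply/funext => y; rewrite /= addr0.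
Qed.

Let gen_stab x v : stab (gen (l x) (l v)).
Proof.
have [[xo xG] xp] := l_stab x; have [[vo vG] vp] := l_stab v.
split; last exact: gen_kill xo xp vp.
split=> [|Y GY]; first exact: skew_gen.
by rewrite (gen_comm xo)//; [rewrite xG|rewrite vG].
Qed.

Let smooth_res (a : R) : smooth_on setT (fun x : E => res (a *: l x)).
Proof.
apply: smooth_inv => [||x _]; first exact: openT.
  have aL : linear (fun x : E => - (a *: l x)).
    by move=> b u v; rewrite linearP scalerDr opprD !scalerA mulrC -scalerA scalerN.
  refine (smooth_add openT (smooth_cst openT (\1%VF : E)) _).
  by apply: (smooth_linear openT) => //; exact: hom_linear_continuous.
by apply: skew_res_inv; apply: (@skew_scale _ _ g); case: (l_stab x) => -[].
Qed.

Let T_smooth : smooth_on setT T.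
Proof.
have smc (a : R) : smooth_on setT (fun x : E => cay (a *: l x)).
  refine (smooth_add openT _ (smooth_cst openT (- \1%VF : E))).
  apply: (@smooth_linear_comp _ _ _ _ _ ( *:%R (2 : R))) => //; first exact: openT.
  - by move=> b u v; rewrite scalerDr !scalerA mulrC.
  - exact: scaler_continuous.
refine (smooth_comp_lfun openT (smooth_comp_lfun openT (smc _) _) (smc _)).
by apply: smooth_cst; exact: openT.
Qed.

Let T0 : T 0 = K0. Proof. by rewrite /T linear0 (orb0 g). Qed.

(** Along the curve from [K0] to [T w] in the orbit, [Q S p] and [p S Q] start at
    zero, and grow at a rate proportional to the norm of [w]; hence they stay
    zero when [w] is small, and the kernel of [P] does not shrink.  It does not
    grow either, because invertibility of [block] is an open condition. *)
Lemma leaf_kernel : exists2 r, 0 < r & forall w : E, `|w| < r ->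
  [/\ UF (T w), invertible (block (Q (T w)) (S (T w)) p) & P (T w) ** p = 0].
Proof.
pose q (x : E) := F (T x); pose sx (x : E) := S (T x).
pose a (x : E) := block (q x) (sx x) p.
pose X (x : E) := pinv (q x) (sx x) p.
pose b (x : E) := (\1%VF - p) ** ((a x)^-1)%VF.
have dT : differentiable T 0 by case: (T_diff 0).
have dFT (H : E -> E) (W : set E) : smooth_on W H -> W K0 ->
    differentiable (H \o T) 0.
  by move=> HW WK; apply: differentiable_comp => //; rewrite T0; exact: (HW [::]).
have dq : differentiable q 0 by exact: dFT FU UFK0.
have dsx : differentiable sx 0 by apply: (dFT _ _ (eqv_smooth eqS)).
have dcomp (f h : E -> E) : differentiable f 0 -> differentiable h 0 ->
    differentiable (fun x => f x ** h x) 0.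
  move=> df dh; have [] // := is_diff_comp_lfun (differentiable_is_diff df)
    (differentiable_is_diff dh).
have dc (c : E) : differentiable (fun _ : E => c) 0 by exact: differentiable_cst.
have da : differentiable a 0.
  apply: (@differentiableD _ _ _
    (fun x => (\1%VF - p) ** (q x ** sx x) ** (\1%VF - p)) (cst p)) => //.
  apply: (dcomp (fun x => (\1%VF - p) ** (q x ** sx x)) (fun=> \1%VF - p)) => //.
  apply: (dcomp (fun=> \1%VF - p) (fun x => q x ** sx x)) => //.
  exact: dcomp.
have ia0 : invertible (a 0) by rewrite /a /q /sx T0.
have dai : differentiable (fun x => ((a x)^-1)%VF) 0.
  have [] // := is_diff_comp (differentiable_is_diff da) (is_diff_inv ia0).
have dX : differentiable X 0.
  apply: (dcomp (fun x => sx x ** (\1%VF - p)) (fun x => ((a x)^-1)%VF)) => //.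
  exact: (dcomp sx).
have db : differentiable b 0.
  exact: (dcomp (fun=> \1%VF - p) (fun x => ((a x)^-1)%VF)).
have ddF : differentiable (fun x => dop F (T x)) 0.
  apply: (@differentiable_comp _ _ _ _ T (dop F)) => //; rewrite T0.
  exact: (smooth_dop oUF FU [::]).
have ddT : differentiable (dop T) 0 by exact: (smooth_dop openT T_smooth [::]).
have bounded (U1 V1 : vectType R) (f : E -> 'Hom(U1, V1)) :
    differentiable f 0 -> \forall x \near (0 : E), `|f x| <= `|f 0| + 1.
  move=> /differentiable_continuous/cvgrPdist_le/(_ 1 ltr01).
  apply: filterS => x fx; have := ler_normB (f 0) (f 0 - f x).
  by rewrite opprB addrCA subrr addr0; lra.
pose m := `|q 0| + `|X 0| + `|b 0| + `|dop F (T 0)| + `|dop T 0| + `|sigma| + 1.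
have sum6 (a1 a2 a3 a4 a5 a6 : R) (z := a1 + a2 + a3 + a4 + a5 + a6 + 1) :
    0 <= a1 -> 0 <= a2 -> 0 <= a3 -> 0 <= a4 -> 0 <= a5 -> 0 <= a6 ->
    [/\ 0 <= z, a1 + 1 <= z, a2 + 1 <= z & a3 + 1 <= z] /\
    [/\ a4 + 1 <= z, a5 + 1 <= z & a6 <= z].
  by rewrite /z => *; split; split; lra.
have [[m0 qm Xm bm] [Fm Tm sm]] := sum6 _ _ _ _ _ _ (normr_ge0 (q 0))
  (normr_ge0 (X 0)) (normr_ge0 (b 0)) (normr_ge0 (dop F (T 0)))
  (normr_ge0 (dop T 0)) (normr_ge0 sigma).
rewrite -/m in m0 qm Xm bm Fm Tm sm.
have [k k0 kP] := growth_bound m0.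
have [e e0 ev] := eval_bounded V V V V.
have nU : \forall x \near (0 : E), UF (T x).
  apply: (differentiable_continuous dT); rewrite T0.
  exact: open_nbhs_nbhs.
have na : \forall x \near (0 : E), invertible (a x).
  apply: (differentiable_continuous da).
  by apply: open_nbhs_nbhs; split=> //; exact: invertible_open.
have /nbhs_norm0P[r1 /= r10 r1P] : \forall x \near (0 : E),
    [/\ UF (T x), invertible (a x), `|q x| <= m, `|X x| <= m &
    [/\ `|b x| <= m, `|dop F (T x)| <= m & `|dop T x| <= m]].
  near=> x; split.
  - by near: x.
  - by near: x.
  - by apply: le_trans qm; near: x; exact: (bounded _ _ q).
  - by apply: le_trans Xm; near: x; exact: (bounded _ _ X).
  - split.
    + by apply: le_trans bm; near: x; exact: (bounded _ _ b).
    + by apply: le_trans Fm; near: x; exact: (bounded _ _ (fun x => dop F (T x))).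
    + by apply: le_trans Tm; near: x; exact: (bounded _ _ (dop T)).
pose K := k * (e * m); have K_ge0 : 0 <= K by rewrite !mulr_ge0.
exists (Num.min r1 (2 * (K + 1))^-1).
  by rewrite lt_min r10 invr_gt0 mulr_gt0// ltr_wpDl.
move=> w; rewrite lt_min => /andP[wr1 wK].
have tw (t : R) : 0 <= t <= 1 -> `|t *: w + 0| < r1.
  move=> /andP[t0 t1]; rewrite addr0 normrZ ger0_norm//.
  by apply: le_lt_trans wr1; rewrite ler_piMl.
have [Uw aw _ _ _] := r1P w wr1.
have FQw : F (T w) = Q (T w) by rewrite FQ//; case: (T_admissible w).
split=> //; first by rewrite -FQw.
pose L (t : R) := T (t *: w + 0).
pose C (t : R) := comm_lfun (gen (l (t *: w + 0)) (l w)) (L t).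
have dL (t : R) : is_diff t L (fun s => s *: C t).
  exact: (is_diff_line (T_diff _)).
have dFL (t : R) : 0 <= t <= 1 ->
    is_diff t (F \o L) (fun s => s *: dop F (L t) (C t)).
  move=> /tw/r1P[UL _ _ _ _]; have := is_diff_comp (dL t) (smooth_is_diff FU UL).
  congr (is_diff_def _ _ _); apply/funext => z.
  by rewrite /= -(dopE _ (smooth_is_diff FU UL)) linearZ.
have sF (t : R) : 0 <= t <= 1 -> is_diff t (fun t => F (L t) ** sigma)
    (fun z => z *: (dop F (L t) (C t) ** sigma)) /\
    is_diff t (fun t => sigma ** F (L t))
    (fun z => z *: (sigma ** dop F (L t) (C t))).
  move=> t01; have sc : is_diff t (fun _ : R => sigma) (fun _ => 0).
    exact: is_diff_cst.
  split.
    have := is_diff_comp_lfun (dFL t t01) sc; congr (is_diff_def _ _ _).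
    by apply/funext => z; rewrite comp_lfun0r add0r -comp_lfunZl.
  have := is_diff_comp_lfun sc (dFL t t01); congr (is_diff_def _ _ _).
  by apply/funext => z; rewrite comp_lfun0l addr0 -comp_lfunZr.
have L0 : L 0 = K0 by rewrite /L scale0r add0r T0.
have aK0 : admissible K0 := admissible0.
have QK0 : Q K0 ** S K0 = S K0 ** Q K0 := QS K0t.
have L1 : L 1 = T w by rewrite /L scale1r addr0.
have -> : P (T w) ** p = F (L 1) ** sigma.
  by rewrite L1 FQw -comp_lfunA S_p//; exact: T_admissible.
apply: (@small_growth_zero _ _ _ (fun t => F (L t) ** sigma)
  (fun t => sigma ** F (L t)) (fun t => dop F (L t) (C t) ** sigma)
  (fun t => sigma ** dop F (L t) (C t)) (K * `|w|)).
- have : K * `|w| <= (K + 1) * `|w| by rewrite ler_wpM2r// lerDl.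
  have : (K + 1) * `|w| < 2^-1.
    rewrite -ltr_pdivlMl ?ltr_wpDl// -invfM mulrC.
    by move: wK; rewrite [2 * _]mulrC.
  lra.
- move=> t t01; have [s1 s2] := sF t t01.
  have [UL aL qL XL [bL FL TL]] := r1P _ (tw t t01).
  have Cle : `|C t| <= e * m * `|w|.
    have := ev (dop T (t *: w + 0)) w; rewrite (dopE _ (T_diff _)).
    move/le_trans; apply; rewrite ler_wpM2r// ler_wpM2l//.
  have [] := kP (L t) _ _ (T_admissible _) UL aL (gen_stab _ _) qL XL bL FL sm Cle.
  by rewrite /K mulrA.
- by rewrite L0 FQ// comp_lfunA; exact: comp_ker_proj.
- rewrite L0 FQ// /sigma (S_comm_p aK0) -comp_lfunA -QK0.
  exact: (ker_proj_comp (P_adj K0t)).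
Unshelve. all: by end_near. Qed.


Variables (h W : {vspace E}).
Hypothesis hP : forall B, B \in h <-> stab B.
Hypothesis WP : forall B, stab B -> comm_lfun B K0 \in W.
Hypothesis l_lift : forall w, w \in W -> comm_lfun (l w) K0 = w.
Hypothesis l_proj : forall x, l (projv W x) = l x.

(** The parametrization of the orbit, completed by a complement of its tangent
    space: the inverse of this map flattens the orbit near [K0]. *)
Let Psi (x : E) : E := T x + (x - projv W x).

Let W_add_proj : linear (fun x : E => x - projv W x).
Proof. by move=> a u v; rewrite linearP opprD addrACA scalerBr. Qed.

Let Psi_diff x : is_diff x Psi
  (fun v => comm_lfun (gen (l x) (l v)) (T x) + (v - projv W v)).
Proof.
have T_x := T_diff x.
have dlin : is_diff x (fun y : E => (y - projv W y) + 0) (fun y => y - projv W y).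
  by apply: is_diff_affine => //; exact: hom_linear_continuous.
have -> : Psi = T + (fun y : E => (y - projv W y) + 0).
  by apply/funext => y; rewrite /Psi fctE addr0.
exact: is_diffD.
Qed.

Let Psi_smooth : smooth_on setT Psi.
Proof.
refine (smooth_add openT T_smooth _).
by apply: (smooth_linear openT) => //; exact: hom_linear_continuous.
Qed.

Let Psi_W w : w \in W -> Psi w = T w.
Proof. by move=> wW; rewrite /Psi projv_id// subrr addr0. Qed.

Let dPsi_W w v : v \in W ->
  dop Psi w v = comm_lfun (gen (l w) (l v)) (T w).
Proof. by move=> vW; rewrite (dopE _ (Psi_diff w)) projv_id// subrr addr0. Qed.

Let dPsi0 : dop Psi 0 = \1%VF.
Proof.
apply/lfunP => v; rewrite (dopE _ (Psi_diff 0)) id_lfunE linear0 T0 (gen0 g).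
by rewrite -l_proj l_lift ?memv_proj// addrC subrK.
Qed.

Let dPsi_near : exists2 r : R, 0 < r & forall x v : E, `|x| < r ->
  `|'D_v Psi x - v| <= 2^-1 * `|v|.
Proof.
have [e e0 ev] := eval_bounded V V V V.
have ddP : differentiable (dop Psi) 0 by exact: (smooth_dop openT Psi_smooth [::]).
have eps0 : 0 < (2 * (e + 1))^-1 by rewrite invr_gt0 mulr_gt0// ltr_wpDl.
have := differentiable_continuous ddP.
move=> /cvgrPdist_le/(_ _ eps0)/nbhs_norm0P[r /= r0 rP]; exists r => // x v xr.
have := rP x xr; rewrite /= dPsi0 => near1.
have -> : 'D_v Psi x - v = - (\1%VF - dop Psi x) v.
  by rewrite !lfE opprB (dopE _ (Psi_diff x)) (is_diff_derive v (Psi_diff x)).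
rewrite normrN; apply: le_trans (ev _ _) _; apply: ler_wpM2r => //.
apply: (@le_trans _ _ ((e + 1) * (2 * (e + 1))^-1)).
  by apply: ler_pM => //; rewrite lerDl.
rewrite invfM mulrCA divff ?mulr1// gt_eqF// ltr_wpDl//.
Qed.

(** The image of [W] under the derivative consists of all velocities of the
    action: it is contained in them, and conjugation bounds their dimension. *)
Let dPsi_onto w B : invertible (dop Psi w) -> stab B ->
  exists2 v, v \in W & dop Psi w v = comm_lfun B (T w).
Proof.
move=> iM sB; set M := dop Psi w in iM *.
pose ad (K : E) : 'End(E) := linfun (fun B : E => comm_lfun B K).
have adE K A : ad K A = comm_lfun A K.
  apply: linear_linfunE => a X Y; exact: (comm_lfun_lin g).
have wo : ortho_alg g (l w) by case: (l_stab w) => -[].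
pose Y := 2^-1 *: l w.
pose cj : 'End(E) := linfun (fun A : E => cay Y ** A ** cay (- Y)).
have cjE A : cj A = cay Y ** A ** cay (- Y).
  apply: linear_linfunE => a X Z.
  move: (cay Y) (cay (- Y)) => c c'.
  by rewrite comp_lfunDr comp_lfunDl -comp_lfunZr -comp_lfunZl.
have sub1 : (M @: W <= ad (T w) @: h)%VS.
  apply/subvP => _ /memv_imgP[v vW ->]; rewrite /M dPsi_W// -adE.
  by apply: memv_img; apply/hP; exact: gen_stab.
have sub2 : (ad (T w) @: h <= cj @: W)%VS.
  apply/subvP => _ /memv_imgP[A /hP[[Ao AG] Ap] ->].
  rewrite adE (comm_orb K0 wo) -cjE; apply: memv_img; apply: WP.
  have [[_ wG] wp] := l_stab w.
  split; last exact: (conj_kill wo).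
  split=> [|X GX]; first exact: (skew_conj wo).
  by rewrite (conj_comm wo)//; [rewrite wG|rewrite AG].
have dimM : \dim (M @: W)%VS = \dim W.
  by apply: limg_dim_eq; have -> := iM; rewrite capv0.
have : (M @: W == ad (T w) @: h)%VS.
  rewrite eqEdim sub1 dimM /=; apply: leq_trans (dimvS sub2) _.
  by rewrite -(limg_ker_dim cj W) leq_addl.
move=> /eqP Mh; have : comm_lfun B (T w) \in (M @: W)%VS.
  by rewrite Mh -adE; apply: memv_img; exact/hP.
by move=> /memv_imgP[v vW ->]; exists v.
Qed.

Lemma leaf_of_lift : exists N, N K0 /\
  [/\ N `<=` twistor g, submanifold N &
      forall L, N L -> tangent_space N L = orbit_distr g G (P L) L].
Proof.
have [r1 r10 kerP] := leaf_kernel.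
have [r2 r20 dP] := dPsi_near.
pose r := Num.min r1 (r2 / 2).
have r0 : 0 < r by rewrite lt_min r10 divr_gt0.
have rr1 (x : E) : `|x| < r -> `|x| < r1 by rewrite lt_min => /andP[].
have rr2 (x : E) : `|x| < 2 * r -> `|x| < r2.
  move=> /lt_le_trans; apply.
  have : r <= r2 / 2 by rewrite ge_min lexx orbT.
  lra.
have PsiU : smooth_on [set x : E | `|x| < 2 * r] Psi.
  by apply: smooth_sub Psi_smooth.
have dP' (x v : E) : `|x| < 2 * r -> `|'D_v Psi x - v| <= 2^-1 * `|v|.
  by move=> /rr2; exact: dP.
have [Phi [oU PhiU PhiP PhiK]] := inverse_function r0 PsiU dP'.
set U := [set y : E | `|y - Psi 0| < r / 2] in oU PhiU PhiP PhiK.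
have Psi0 : Psi 0 = K0 by rewrite Psi_W ?mem0v// T0.
pose N := [set L | U L /\ exists w, [/\ w \in W, `|w| < r & L = T w]].
exists N; split.
  split; first by rewrite /U /= Psi0 subrr normr0 divr_gt0.
  by exists 0; rewrite mem0v normr0 r0 T0.
have openB : open [set x : E | `|x| < r].
  rewrite (_ : [set x | _] = ball (0 : E) r); first exact: ball_open.
  by apply/seteqP; split=> x; rewrite -ball_normE /= sub0r normrN.
have PsiC (x : E) : {for x, continuous Psi}.
  by have [/differentiable_continuous] := Psi_diff x.
have oD : open [set x : E | `|x| < r /\ U (Psi x)].
  rewrite (_ : [set x | _] = [set x : E | `|x| < r] `&` Psi @^-1` U)//.
  by apply: openI => //; apply: open_comp => // x _; exact: PsiC.
have PhiE : Phi @` U = [set x : E | `|x| < r /\ U (Psi x)].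
  apply/seteqP; split=> [_ [y Uy <-]|x [xr Ux]].
    by have [yr yE] := PhiP y Uy; rewrite /= yE.
  by exists (Psi x) => //; exact: PhiK.
split.
- move=> _ [_ [w [_ _ ->]]]; by case: (T_admissible w).
- exists W => L [UL _]; exists U, Phi, Psi; split=> //.
  rewrite /slice_chart PhiE; split=> //.
  + by apply: smooth_sub Psi_smooth.
  + by move=> y; rewrite inE => /PhiP[].
  + apply/seteqP; split=> [_ [y [Uy [_ [w [wW wr yT]]]] <-]|x [[xr Ux] xW]].
      have yE : y = Psi w by rewrite Psi_W.
      by rewrite yE PhiK// -?yE//; split=> //; split=> //; rewrite -yE.
    exists (Psi x); last exact: PhiK.
    by split=> //; split=> //; exists x; rewrite Psi_W.
move=> L [UL [w [wW wr LE]]].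
have [_ iw Pp] := kerP w (rr1 _ wr).
have wr2 : `|w| < 2 * r.
  by apply: lt_trans wr _; rewrite ltr_pMl// ltr1n.
have iM : invertible (dop Psi w) by exact: (dop_invertible PsiU dP').
have PsiL : Psi w = L by rewrite Psi_W.
have Lt : twistor g L by rewrite LE; case: (T_admissible w).
have aL : admissible L by rewrite LE.
have orbE : orbit_distr g G (P L) L = [set C | exists2 B, stab B & C = comm_lfun B L].
  rewrite LE; apply/seteqP; split=> C.
    move=> [B [sB kB ->]]; exists B => //; split=> //; apply/lfunP => v.
    by rewrite comp_lfunE zero_lfunE kB// -comp_lfunE Pp zero_lfunE.
  move=> [B [sB Bp] ->]; exists B; split=> // v Pv.
  have <- : p v = v.
    by apply: (block_ker pp iw Pp); rewrite -comp_lfunE.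
  by rewrite -comp_lfunE Bp zero_lfunE.
rewrite orbE; apply/seteqP; split=> X.
- move=> [e [c [e0 cS c0 cN <-]]].
  have B0 : ball (0 : R) e 0 by exact: ballxx.
  have dc : is_diff 0 c (fun s => 'D_s c 0) by exact: smooth_is_diff cS B0.
  have dPhi : is_diff (c 0) Phi (fun v => 'D_v Phi (c 0)).
    by rewrite c0; exact: (smooth_is_diff PhiU UL).
  have dw := is_diff_comp dc dPhi.
  have Phic0 : Phi (c 0) = w by rewrite c0 -PsiL PhiK// PsiL.
  have nearB : \forall t \near (0 : R), ball (0 : R) e t by exact: nbhsx_ballx.
  set v := 'D_('D_1 c 0) Phi (c 0).
  have vW : v \in W.
    (* The velocity stays in [W], which is the kernel of a linear map. *)
    pose pr (x : E) : E := (x - projv W x) + 0.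
    have dpr : is_diff (Phi (c 0)) pr (fun x => x - projv W x).
      by apply: is_diff_affine => //; exact: hom_linear_continuous.
    have d1 := is_diff_comp dw dpr.
    have d0 : is_diff (0 : R) (fun _ : R => 0 : E) (fun=> 0) by exact: is_diff_cst.
    have near0 : \forall t \near (0 : R), (fun _ : R => 0 : E) t = (pr \o (Phi \o c)) t.
      apply: filterS nearB => t /cN[Ut [z [zW zr cz]]].
      rewrite /pr /= cz -(Psi_W zW) PhiK//; last by rewrite (Psi_W zW) -cz.
      by rewrite projv_id// subrr addr0.
    have [_ e1] := near_is_diff near0 d0; have [_ e2] := d1.
    have := congr1 (fun f => f 1) (etrans (esym e1) e2) => /= /esym/eqP.
    by rewrite subr_eq0 -/v => /eqP ->; exact: memv_proj.
  have d2 := is_diff_comp dw (Psi_diff (Phi (c 0))).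
  have near1 : \forall t \near (0 : R), (Psi \o (Phi \o c)) t = c t.
    apply: filterS nearB => t /cN[Ut _] /=.
    by have [_ ->] := PhiP _ Ut.
  have [_ e1] := near_is_diff near1 d2; have [_ e2] := dc.
  have := congr1 (fun f => f 1) (etrans (esym e2) e1) => /= ->.
  rewrite Phic0 -/v -(dopE _ (Psi_diff w)) dPsi_W//.
  by exists (gen (l w) (l v)); rewrite ?LE//; exact: gen_stab.
- move=> [B sB ->]; have [v vW] := dPsi_onto iM sB; rewrite -LE => vE.
  pose c (t : R) := Psi (t *: v + w).
  have c0 : c 0 = L by rewrite /c scale0r add0r.
  have dc : is_diff 0 c (fun t => t *: dop Psi w v).
    rewrite (dopE _ (Psi_diff w)).
    have := @is_diff_line _ _ _ Psi
      (fun v => comm_lfun (gen (l w) (l v)) (T w) + (v - projv W v)) w v 0.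
    by apply; rewrite scale0r add0r.
  have cC : {for 0, continuous c} by have [/differentiable_continuous] := dc.
  have lineC : {for 0, continuous (fun t : R => t *: v + w)}.
    by apply: cvgD; [exact: scalel_continuous|exact: cvg_cst].
  have nearN : \forall t \near (0 : R), U (c t) /\ `|t *: v + w| < r.
    have nU : \forall t \near (0 : R), U (c t).
      by apply: cC; rewrite c0; exact: open_nbhs_nbhs.
    have nr : \forall t \near (0 : R), [set x : E | `|x| < r] (t *: v + w).
      by apply: lineC; rewrite scale0r add0r; exact: open_nbhs_nbhs.
    by apply: filterS2 nU nr.
  have [e e0 eP] := (nbhs_ballP _ _).1 nearN.
  exists e, c; split=> //.
  + apply: (smooth_line (U := setT)) => //; first exact: openT.
    exact: ball_open.
  + move=> t /eP[Ut tr]; split=> //; exists (t *: v + w).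
    have tW : t *: v + w \in W by rewrite memvD// memvZ.
    by split=> //; rewrite /c Psi_W.
  + by rewrite (is_diff_derive _ dc) scale1r vE.
Qed.

End Parametrization.

(** The linear map [l] selects, for a tangent vector at [K0], an infinitesimal
    symmetry that generates it. *)
Lemma leaf_at : exists N, N K0 /\
  [/\ N `<=` twistor g, submanifold N &
      forall L, N L -> tangent_space N L = orbit_distr g G (P L) L].
Proof.
have [h hP] := linear_set_vspace stab0 stab_lin.
pose ad : 'End(E) := linfun (fun B : E => comm_lfun B K0).
have adE A : ad A = comm_lfun A K0.
  apply: linear_linfunE => a X Y; exact: (comm_lfun_lin g).
pose f : 'End(E) := (ad \o projv h)%VF.
pose W := limg f.
pose l : 'End(E) := (projv h \o f^-1 \o projv W)%VF.
apply: (@leaf_of_lift l _ h W) => //.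
- by move=> x; apply/hP; rewrite /l !comp_lfunE memv_proj.
- move=> B /hP Bh; rewrite -adE -[X in ad X](projv_id Bh) -comp_lfunE.
  by rewrite memv_img// memvf.
- move=> w wW; rewrite -adE /l !comp_lfunE (projv_id wW).
  by rewrite -[ad _]comp_lfunE -/f limg_lfunVK.
- by move=> x; rewrite /l !comp_lfunE projv_proj.
Qed.

End AtBasePoint.

Theorem leaf K0 : twistor g K0 -> exists N, N K0 /\
  [/\ N `<=` twistor g, submanifold N &
      forall L, N L -> tangent_space N L = orbit_distr g G (P L) L].
Proof.
move=> K0t; have [F [U [oU UK0 FU FQ]]] := Q_smooth K0t.
exact: (@leaf_at K0 F U).
Qed.

End Leaf.

(** * Integrability *)

Theorem theorem5p8 (R : realType) (V : vectType R) (n : nat)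
    (g : {dot V for idfun}) (J : 'End(V)) (Q S : 'End(V) -> 'End(V))
    (dimV : \dim {:V} = (2 * n)%N)
    (dimV_ge4 : (4 <= \dim {:V})%N)
    (J_twistor : twistor g J)
    (Q_smooth : smooth_section g Q)
    (Q_adj : forall K, twistor g K -> self_adjoint g (Q K))
    (Q_J : forall K, twistor g K -> comm_lfun (Q K) J = 0)
    (Q_phi : forall K, twistor g K -> comm_lfun (Q K) K = 0)
    (S_in : S_sections J S) :
  ((forall K, twistor g K -> forall B, distr g S K B ->
      dsection g Q K (Q K \o B \o Q K)%VF =
        (Q K \o dsection g Q K B \o Q K)%VF) ->
    integrable_distr g (distr g (fun K => (Q K \o S K)%VF)))
  /\
  ((forall K, twistor g K -> forall C, distr_u g J S K C ->
      dsection g Q K (Q K \o C \o Q K)%VF =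
        (Q K \o dsection g Q K C \o Q K)%VF) ->
    integrable_distr g (distr_u g J (fun K => (Q K \o S K)%VF))).
Proof.
have [s eqS] := S_sections_equivariant J_twistor S_in.
have PA := P_adj Q_adj Q_J Q_phi eqS; have PK := P_ker Q_J Q_phi eqS.
split=> dQ K0 K0t.
- have dQ' K (Kt : twistor g K) A : skew_centralizer g set0 A ->
      (forall v, S K v = 0 -> A v = 0) ->
      dsection g Q K (Q K \o comm_lfun A K \o Q K)%VF =
      (Q K \o dsection g Q K (comm_lfun A K) \o Q K)%VF.
    move=> Ac Ak; apply: dQ => //.
    rewrite (distrE Kt (eqv_adj eqS Kt)); first by exists A.
    by move=> v /(eqv_ker eqS Kt)[].
  have [N [NK0 [Nt Ns NT]]] := leaf J_twistor Q_smooth Q_adj Q_J Q_phi eqS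
    (@sub0set _ _) dQ' K0t.
  exists N; split=> //; split=> // L NL; have Lt := Nt L NL.
  rewrite NT// (distrE (P := fun K => (Q K \o S K)%VF) Lt (PA L Lt))//.
  by move=> v /(PK L Lt)[].
- have dQ' K (Kt : twistor g K) A : skew_centralizer g [set J] A ->
      (forall v, S K v = 0 -> A v = 0) ->
      dsection g Q K (Q K \o comm_lfun A K \o Q K)%VF =
      (Q K \o dsection g Q K (comm_lfun A K) \o Q K)%VF.
    move=> Ac Ak; apply: dQ => //.
    by rewrite (distr_uE J Kt (eqv_adj eqS Kt)); exists A.
  have [N [NK0 [Nt Ns NT]]] := leaf J_twistor Q_smooth Q_adj Q_J Q_phi eqS
    (@subset_refl _ _) dQ' K0t.
  exists N; split=> //; split=> // L NL; have Lt := Nt L NL.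
  by rewrite NT// (distr_uE J (P := fun K => (Q K \o S K)%VF) Lt (PA L Lt)).
Qed.
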